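(* Let $m\ge 5$ and let $\mathcal{G}=\{G_v : v\in V(C_m^{\mathrm{opp}})\}$ be any collection of nontrivial groups. Then the graph product $GP(C_m^{\mathrm{opp}},\mathcal{G})$ contains a hyperbolic surface group.
   Context: $C_m$ denotes the cycle graph of length $m$, and the opposite graph $\Gamma^{\mathrm{opp}}$ of a graph $\Gamma$ has the same vertices, with two distinct vertices adjacent in $\Gamma^{\mathrm{opp}}$ exactly when they are non-adjacent in $\Gamma$. For a graph $\Gamma$ and groups $\mathcal{G}=\{G_v: v\in V(\Gamma)\}$, the graph product $GP(\Gamma,\mathcal{G})$ is the quotient of the free product of the groups $G_v$ by the normal closure of $\{[g,h] : g\in G_u, h\in G_v, \{u,v\}\in E(\Gamma)\}$. A hyperbolic surface group is the fundamental group of a closed hyperbolic surface; ''contains'' means as an isomorphic copy of a subgroup. *)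

(* Defs.v *)
From HB Require Import structures.
From mathcomp Require Import all_boot all_order all_algebra generic_quotient.
From mathcomp Require Import monoid.
From mathcomp Require Import all_classical all_reals all_analysis.
From mathcomp Require Import lra.
Import Order.TTheory GRing.Theory Num.Theory numFieldNormedType.Exports.

Set Implicit Arguments.
Unset Strict Implicit.
Unset Printing Implicit Defensive.

Local Open Scope classical_set_scope.

(* Groups are [groupType]s (possibly infinite).  Such a type carries a choice
   structure, which is no restriction on the group since every type has one
   classically ([gen_eqMixin], [gen_choiceMixin]).                            *)

Section group_notions.
Local Open Scope group_scope.

Definition nontrivial_group (G : groupType) : Prop := exists g : G, g <> 1.

Definition isomorphic_groups (G H : groupType) : Prop :=
  exists f : {multiplicative G -> H}, bijective f.

(* G contains an isomorphic copy of H as a subgroup. *)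
Definition contains_copy (G H : groupType) : Prop :=
  exists f : {multiplicative H -> G}, injective f.

End group_notions.

(* A set with operations satisfying the group laws up to a compatible
   equivalence relation; [pregroup_quotient] is its quotient group.           *)
Record pregroup := Pregroup {
  pg_sort :> choiceType;
  pg_eqv : pg_sort -> pg_sort -> Prop;
  pg_one : pg_sort;
  pg_inv : pg_sort -> pg_sort;
  pg_mul : pg_sort -> pg_sort -> pg_sort;
  pg_refl : forall x, pg_eqv x x;
  pg_sym : forall x y, pg_eqv x y -> pg_eqv y x;
  pg_trans : forall y x z, pg_eqv x y -> pg_eqv y z -> pg_eqv x z;
  pg_mul_eqv : forall x x' y y',
    pg_eqv x x' -> pg_eqv y y' -> pg_eqv (pg_mul x y) (pg_mul x' y');
  pg_inv_eqv : forall x x', pg_eqv x x' -> pg_eqv (pg_inv x) (pg_inv x');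
  pg_mulA : forall x y z,
    pg_eqv (pg_mul x (pg_mul y z)) (pg_mul (pg_mul x y) z);
  pg_mul1 : forall x, pg_eqv (pg_mul pg_one x) x;
  pg_mulr1 : forall x, pg_eqv (pg_mul x pg_one) x;
  pg_mulV : forall x, pg_eqv (pg_mul (pg_inv x) x) pg_one;
  pg_mulrV : forall x, pg_eqv (pg_mul x (pg_inv x)) pg_one }.

Section pregroup_quotient.
Local Open Scope quotient_scope.
Variable P : pregroup.

Definition pg_rel : rel P := fun x y => `[< pg_eqv x y >].

Fact pg_rel_refl : reflexive pg_rel.
Proof. by move=> x; apply/asboolP; exact: pg_refl. Qed.

Fact pg_rel_sym : symmetric pg_rel.
Proof. by move=> x y; apply/asboolP/asboolP => /pg_sym. Qed.

Fact pg_rel_trans : transitive pg_rel.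
Proof.
by move=> y x z /asboolP xy /asboolP yz; apply/asboolP; apply: pg_trans xy yz.
Qed.

Canonical pg_equiv : equiv_rel P :=
  EquivRel pg_rel pg_rel_refl pg_rel_sym pg_rel_trans.

Definition pregroup_quotient := {eq_quot pg_equiv}.
HB.instance Definition _ := Choice.on pregroup_quotient.

Definition pg_pi (x : P) : pregroup_quotient := \pi_({eq_quot pg_equiv}) x.

Definition pg_repr (a : pregroup_quotient) : P :=
  repr (a : {eq_quot pg_equiv}).

Lemma pg_reprK a : pg_pi (pg_repr a) = a.
Proof. exact: reprK. Qed.

Lemma pg_piP x y : pg_pi x = pg_pi y <-> pg_eqv x y.
Proof.
split; first by move/(@eqmodP _ pg_equiv)/asboolP.
by move=> xy; apply/(@eqmodP _ pg_equiv)/asboolP.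
Qed.

Lemma pg_repr_pi x : pg_eqv (pg_repr (pg_pi x)) x.
Proof. by apply/pg_piP; rewrite pg_reprK. Qed.

Let one := pg_pi (pg_one P).
Let inv a := pg_pi (pg_inv (pg_repr a)).
Let mul a b := pg_pi (pg_mul (pg_repr a) (pg_repr b)).

Let mul_pi x y : mul (pg_pi x) (pg_pi y) = pg_pi (pg_mul x y).
Proof. by apply/pg_piP/pg_mul_eqv; exact: pg_repr_pi. Qed.

Let inv_pi x : inv (pg_pi x) = pg_pi (pg_inv x).
Proof. by apply/pg_piP/pg_inv_eqv; exact: pg_repr_pi. Qed.

Let mulA : associative mul.
Proof.
move=> a b c; rewrite -[a]pg_reprK -[b]pg_reprK -[c]pg_reprK !mul_pi.
exact/pg_piP/pg_mulA.
Qed.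

Let mul1 : left_id one mul.
Proof. by move=> a; rewrite -[a]pg_reprK mul_pi; exact/pg_piP/pg_mul1. Qed.

Let mulr1 : right_id one mul.
Proof. by move=> a; rewrite -[a]pg_reprK mul_pi; exact/pg_piP/pg_mulr1. Qed.

Let mulV : left_inverse one inv mul.
Proof.
by move=> a; rewrite -[a]pg_reprK inv_pi mul_pi; exact/pg_piP/pg_mulV.
Qed.

Let mulrV : right_inverse one inv mul.
Proof.
by move=> a; rewrite -[a]pg_reprK inv_pi mul_pi; exact/pg_piP/pg_mulrV.
Qed.

HB.instance Definition _ :=
  isGroup.Build pregroup_quotient mulA mul1 mulr1 mulV mulrV.

Lemma pg_pi1 : pg_pi (pg_one P) = 1%g.
Proof. by []. Qed.

Lemma pg_piM x y : pg_pi (pg_mul x y) = (pg_pi x * pg_pi y)%g.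
Proof. by rewrite -mul_pi. Qed.

Lemma pg_piV x : pg_pi (pg_inv x) = (pg_pi x)^-1%g.
Proof. by rewrite -inv_pi. Qed.

End pregroup_quotient.

Section quotient_group.
Local Open Scope group_scope.
Variable G : groupType.

Record normal_subgroup := NormalSubgroup {
  ns_set :> G -> Prop;
  ns_1 : ns_set 1;
  ns_M : forall x y, ns_set x -> ns_set y -> ns_set (x * y);
  ns_V : forall x, ns_set x -> ns_set x^-1;
  ns_J : forall x y, ns_set x -> ns_set (x ^ y) }.

Section normal_closure.
Variable S : set G.

Definition normal_closure_set : set G :=
  [set x | forall N : normal_subgroup, S `<=` N -> N x].

Fact normal_closure1 : normal_closure_set 1.
Proof. by move=> N _; exact: ns_1. Qed.

Fact normal_closureM x y : normal_closure_set x -> normal_closure_set y ->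
  normal_closure_set (x * y).
Proof. by move=> Sx Sy N SN; apply: ns_M; [exact: Sx|exact: Sy]. Qed.

Fact normal_closureV x : normal_closure_set x -> normal_closure_set x^-1.
Proof. by move=> Sx N SN; apply: ns_V; exact: Sx. Qed.

Fact normal_closureJ x y : normal_closure_set x -> normal_closure_set (x ^ y).
Proof. by move=> Sx N SN; apply: ns_J; exact: Sx. Qed.

Definition normal_closure : normal_subgroup :=
  NormalSubgroup normal_closure1 normal_closureM normal_closureV
    normal_closureJ.

End normal_closure.

Variable N : normal_subgroup.

Definition coset_eqv (x y : G) : Prop := N (x^-1 * y).

Fact coset_refl x : coset_eqv x x.
Proof. by rewrite /coset_eqv mulVg; exact: ns_1. Qed.

Fact coset_sym x y : coset_eqv x y -> coset_eqv y x.
Proof. by move=> /ns_V; rewrite /coset_eqv invgM invgK. Qed.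

Fact coset_trans y x z : coset_eqv x y -> coset_eqv y z -> coset_eqv x z.
Proof. by move=> xy /(ns_M xy); rewrite /coset_eqv mulgA mulgK. Qed.

Fact coset_mul x x' y y' :
  coset_eqv x x' -> coset_eqv y y' -> coset_eqv (x * y) (x' * y').
Proof.
move=> /(@ns_J N _ y) xx' /(ns_M xx').
by rewrite /coset_eqv /conjg invgM -!mulgA mulVKg.
Qed.

Fact coset_inv x x' : coset_eqv x x' -> coset_eqv x^-1 x'^-1.
Proof.
by move=> /ns_V/(@ns_J N _ x^-1); rewrite /coset_eqv /conjg !invgM !invgK mulgK.
Qed.

Let eq_coset x y : x = y -> coset_eqv x y.
Proof. by move=> ->; exact: coset_refl. Qed.

Definition quotient_pregroup : pregroup :=
  @Pregroup G coset_eqv 1 (fun x => x^-1) (fun x y => x * y)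
    coset_refl coset_sym coset_trans coset_mul coset_inv
    (fun x y z => eq_coset (mulgA x y z))
    (fun x => eq_coset (mul1g x)) (fun x => eq_coset (mulg1 x))
    (fun x => eq_coset (mulVg x)) (fun x => eq_coset (mulgV x)).

Definition quotient_group : groupType := pregroup_quotient quotient_pregroup.

End quotient_group.

(* The free product, as words in the disjoint union of the G_v modulo the
   congruence generated by (v,g)(v,h) = (v,gh) and (v,1) = empty word.        *)
Section free_product.
Local Open Scope group_scope.
Variables (V : choiceType) (G : V -> groupType).

Definition syllable : choiceType := {v : V & G v}.
Definition syl (v : V) (g : G v) : syllable := existT (fun v => G v : Type) v g.
Definition fp_word : choiceType := seq syllable.

Inductive fp_eqv : fp_word -> fp_word -> Prop :=
| fp_refl w : fp_eqv w w
| fp_sym w w' : fp_eqv w w' -> fp_eqv w' w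
| fp_trans w2 w1 w3 : fp_eqv w1 w2 -> fp_eqv w2 w3 -> fp_eqv w1 w3
| fp_merge (w w' : fp_word) v (g h : G v) :
    fp_eqv (w ++ [:: syl g; syl h] ++ w') (w ++ [:: syl (g * h)] ++ w')
| fp_drop (w w' : fp_word) v :
    fp_eqv (w ++ [:: syl (1 : G v)] ++ w') (w ++ w').

Definition fp_inv (w : fp_word) : fp_word :=
  rev [seq syl (tagged s)^-1 | s : syllable <- w].

Fact fp_eqv_ctx (u u' w w' : fp_word) :
  fp_eqv w w' -> fp_eqv (u ++ w ++ u') (u ++ w' ++ u').
Proof.
elim=> {w w'}.
- by move=> w; exact: fp_refl.
- by move=> w w' _; exact: fp_sym.
- by move=> w2 w1 w3 _ ih1 _ ih2; exact: fp_trans ih1 ih2.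
- move=> w w' v g h; have := fp_merge (u ++ w) (w' ++ u') g h.
  by rewrite -!catA.
- move=> w w' v; have := fp_drop (u ++ w) (w' ++ u') v.
  by rewrite -!catA.
Qed.

Fact fp_mul_eqv (w1 w1' w2 w2' : fp_word) :
  fp_eqv w1 w1' -> fp_eqv w2 w2' -> fp_eqv (w1 ++ w2) (w1' ++ w2').
Proof.
move=> e1 e2; apply: (@fp_trans (w1' ++ w2)).
  exact: (fp_eqv_ctx [::] w2 e1).
by have := fp_eqv_ctx w1' [::] e2; rewrite !cats0.
Qed.

Fact fp_inv_eqv w w' : fp_eqv w w' -> fp_eqv (fp_inv w) (fp_inv w').
Proof.
elim=> {w w'}.
- by move=> w; exact: fp_refl.
- by move=> w w' _; exact: fp_sym.
- by move=> w2 w1 w3 _ ih1 _ ih2; exact: fp_trans ih1 ih2.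
- move=> w w' v g h; rewrite /fp_inv !map_cat !rev_cat -!catA /= invgM.
  exact: fp_merge.
- move=> w w' v; rewrite /fp_inv !map_cat !rev_cat -!catA /= invg1.
  exact: fp_drop.
Qed.

Fact fp_mulV w : fp_eqv (fp_inv w ++ w) [::].
Proof.
elim: w => [|[v g] w ih]; first exact: fp_refl.
rewrite /fp_inv /= rev_cons -cats1 -catA.
apply: fp_trans ih; apply: (@fp_trans (fp_inv w ++ [:: syl (1 : G v)] ++ w)).
  by have := fp_merge (fp_inv w) w g^-1 g; rewrite mulVg.
exact: fp_drop.
Qed.

Fact fp_invK w : fp_inv (fp_inv w) = w.
Proof.
rewrite /fp_inv map_rev revK -map_comp -[RHS]map_id; apply: eq_map => -[v g] /=.
by rewrite /syl /= invgK.
Qed.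

Fact fp_mulrV w : fp_eqv (w ++ fp_inv w) [::].
Proof. by have := fp_mulV (fp_inv w); rewrite fp_invK. Qed.

Fact fp_mulA (u v w : fp_word) : fp_eqv (u ++ v ++ w) ((u ++ v) ++ w).
Proof. by rewrite catA; exact: fp_refl. Qed.

Fact fp_mulr1 (w : fp_word) : fp_eqv (w ++ [::]) w.
Proof. by rewrite cats0; exact: fp_refl. Qed.

Definition free_product_pregroup : pregroup :=
  @Pregroup fp_word fp_eqv [::] fp_inv (fun u w => u ++ w)
    fp_refl fp_sym fp_trans fp_mul_eqv fp_inv_eqv fp_mulA
    fp_refl fp_mulr1 fp_mulV fp_mulrV.

Definition free_product : groupType := pregroup_quotient free_product_pregroup.

Definition fp_inj (v : V) (g : G v) : free_product :=
  pg_pi ([:: syl g] : free_product_pregroup).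

End free_product.

Record sgraph (V : Type) := SGraph {
  adj :> rel V;
  adj_sym : symmetric adj;
  adj_irr : irreflexive adj }.

Section graph_product.
Local Open Scope group_scope.
Variables (V : choiceType) (Gamma : sgraph V) (G : V -> groupType).

Definition edge_commutators : set (free_product G) :=
  [set c | exists (u v : V) (g : G u) (h : G v),
     Gamma u v /\ c = [~ fp_inj g, fp_inj h]].

Definition graph_product : groupType :=
  quotient_group (normal_closure edge_commutators).

End graph_product.

Section opposite_graph.
Variables (V : eqType) (Gamma : sgraph V).

Definition opp_adj : rel V := fun u v => (u != v) && ~~ Gamma u v.

Fact opp_adj_sym : symmetric opp_adj.
Proof. by move=> u v; rewrite /opp_adj eq_sym adj_sym. Qed.

Fact opp_adj_irr : irreflexive opp_adj.
Proof. by move=> u; rewrite /opp_adj eqxx. Qed.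

Definition opp_graph : sgraph V := SGraph opp_adj_sym opp_adj_irr.

End opposite_graph.

Section cycle_graph.
Variable m : nat.

(* [ordS] is the successor modulo m; this is the usual cycle for 3 <= m. *)
Definition cycle_adj : rel 'I_m :=
  fun i j => (i != j) && ((j == ordS i) || (i == ordS j)).

Fact cycle_adj_sym : symmetric cycle_adj.
Proof. by move=> i j; rewrite /cycle_adj eq_sym orbC. Qed.

Fact cycle_adj_irr : irreflexive cycle_adj.
Proof. by move=> i; rewrite /cycle_adj eqxx. Qed.

Definition cycle_graph : sgraph 'I_m := SGraph cycle_adj_sym cycle_adj_irr.

End cycle_graph.

(* The fundamental group.  Only the restrictions of a loop to [0, 1] and of a
   homotopy to [0, 1]^2 matter.                                               *)
Section fundamental_group.
Local Open Scope ring_scope.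
Context {R : realType} {X : topologicalType}.

Record loop (x : X) := Loop {
  loop_fun :> R -> X;
  loop_cts : {within `[0, 1], continuous loop_fun};
  loop0 : loop_fun 0 = x;
  loop1 : loop_fun 1 = x }.

HB.instance Definition _ (x : X) := gen_eqMixin (loop x).
HB.instance Definition _ (x : X) := gen_choiceMixin (loop x).

Variable x : X.
Implicit Types p q r : loop x.

(* [H (s, t)]: s is the deformation parameter, t the loop parameter. *)
Definition homotopic p q : Prop :=
  exists H : R * R -> X,
    [/\ {within `[0, 1] `*` `[0, 1], continuous H},
        forall t : R, 0 <= t <= 1 -> H (0, t) = p t,
        forall t : R, 0 <= t <= 1 -> H (1, t) = q t,
        forall s : R, 0 <= s <= 1 -> H (s, 0) = x &
        forall s : R, 0 <= s <= 1 -> H (s, 1) = x].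

Let within_comp (T U W : topologicalType) (A : set T) (B : set U)
    (f : T -> U) (g : U -> W) : (forall t, A t -> B (f t)) ->
  {within A, continuous f} -> {within B, continuous g} ->
  {within A, continuous (g \o f)}.
Proof.
move=> AB /subspace_continuousP cf /subspace_continuousP cg.
apply/subspace_continuousP => t At W' /= nW.
have := cg _ (AB _ At) _ nW; rewrite /nbhs /= => Wg.
have := cf _ At _ Wg; rewrite /nbhs /= /within /= => h.
by near=> s => As; apply: (near h s) => //; exact: AB.
Unshelve. all: by end_near. Qed.

Let glue (T : topologicalType) (A : set T) (u : T -> R) (f g : T -> X) :
  closed A -> continuous u ->
  {within A `&` [set t | u t <= 2^-1], continuous f} ->
  {within A `&` [set t | 2^-1 <= u t], continuous g} ->
  (forall t, A t -> u t = 2^-1 -> f t = g t) ->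
  {within A, continuous (fun t => if u t <= 2^-1 then f t else g t)}.
Proof.
move=> cA cu cf cg fg.
have -> : A = (A `&` [set t | u t <= 2^-1]) `|` (A `&` [set t | 2^-1 <= u t]).
  rewrite -setIUr; apply/esym/setIidPl => t _ /=.
  by case: (leP (u t) 2^-1) => [|/ltW]; [left|right].
apply: withinU_continuous.
- apply: closedI => //; apply: (@preimage_closed _ _ u [set a | a <= 2^-1]).
    by move=> ? _; exact: cu.
  exact: closed_le.
- apply: closedI => //; apply: (@preimage_closed _ _ u [set a | 2^-1 <= a]).
    by move=> ? _; exact: cu.
  exact: closed_ge.
- apply: subspace_eq_continuous cf => t; rewrite inE => -[_ /= ut].
  by rewrite /from_subspace ut.
- apply: subspace_eq_continuous cg => t; rewrite inE => -[At /= ut].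
  rewrite /from_subspace; case: leP => // ut'; apply/esym/fg => //.
  by apply/eqP; rewrite eq_le ut ut'.
Qed.

Let I2 : set (R * R) := `[0, 1] `*` `[0, 1].

Let I2P s t : I2 (s, t) <-> 0 <= s <= 1 /\ 0 <= t <= 1.
Proof. by rewrite /I2 /= !in_itv. Qed.

Let closed_I : closed (`[0, 1] : set R).
Proof. exact: interval_closed. Qed.

Let closed_I2 : closed I2.
Proof.
have -> : I2 = (fst @^-1` `[0, 1]) `&` (snd @^-1` `[0, 1]) by [].
by apply: closedI; apply: preimage_closed => // ? _;
  [exact: cvg_fst|exact: cvg_snd].
Qed.

Let contD (T : topologicalType) (u v : T -> R) :
  continuous u -> continuous v -> continuous (fun t => u t + v t).
Proof. by move=> cu cv t; exact: (cvgD (cu t) (cv t)). Qed.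

Let contB (T : topologicalType) (u v : T -> R) :
  continuous u -> continuous v -> continuous (fun t => u t - v t).
Proof. by move=> cu cv t; exact: (cvgB (cu t) (cv t)). Qed.

Let contM (T : topologicalType) (u v : T -> R) :
  continuous u -> continuous v -> continuous (fun t => u t * v t).
Proof. by move=> cu cv t; exact: (cvgM (cu t) (cv t)). Qed.

Let cont_cst (T : topologicalType) (c : R) : continuous (fun _ : T => c).
Proof. by move=> t; exact: cvg_cst. Qed.

Let cont_id : continuous (fun t : R => t).
Proof. by move=> t; exact: cvg_id. Qed.

Let cont_fst : continuous (fun z : R * R => z.1).
Proof. by move=> z; exact: cvg_fst. Qed.

Let cont_snd : continuous (fun z : R * R => z.2).
Proof. by move=> z; exact: cvg_snd. Qed.

Let cont_comp (T : topologicalType) (u : T -> R) (v : R -> R) :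
  continuous u -> continuous v -> continuous (fun t => v (u t)).
Proof. by move=> cu cv t; exact: (cvg_comp _ _ (cu t) (cv (u t))). Qed.

Let cont_pair (T : topologicalType) (u v : T -> R) :
  continuous u -> continuous v -> continuous (fun t => (u t, v t)).
Proof. by move=> cu cv t; exact: (cvg_pair (cu t) (cv t)). Qed.

Let homotopic_line (p q r : loop x) (phi psi : R -> R) :
  continuous phi -> continuous psi ->
  (forall t : R, 0 <= t <= 1 -> 0 <= phi t <= 1) ->
  (forall t : R, 0 <= t <= 1 -> 0 <= psi t <= 1) ->
  (phi 0 = psi 0) -> (phi 1 = psi 1) ->
  (forall t : R, 0 <= t <= 1 -> q t = p (phi t)) ->
  (forall t : R, 0 <= t <= 1 -> r t = p (psi t)) ->
  homotopic q r.
Proof.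
move=> cphi cpsi Iphi Ipsi e0 e1 qE rE.
have i0 : 0 <= (0 : R) <= 1 by apply/andP; split; lra.
have i1 : 0 <= (1 : R) <= 1 by apply/andP; split; lra.
exists (p \o (fun z => (1 - z.1) * phi z.2 + z.1 * psi z.2)); split => /=.
- apply: (@within_comp (R * R)%type R X I2 `[0, 1]%classic
    (fun z => (1 - z.1) * phi z.2 + z.1 * psi z.2) p); last exact: loop_cts.
  + move=> [s t] /I2P[s01 /[dup] /Iphi ? /Ipsi ?] /=; rewrite in_itv /=.
    by apply/andP; split; nra.
  + apply: continuous_subspaceT; apply: contD; apply: contM => //.
    * exact: contB.
    * exact: cont_comp.
    * exact: cont_comp.
- by move=> t t01; rewrite subr0 mul1r mul0r addr0 -qE.
- by move=> t t01; rewrite subrr mul0r mul1r add0r -rE.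
- by move=> s _; rewrite e0 -mulrDl subrK mul1r -rE ?loop0.
- by move=> s _; rewrite e1 -mulrDl subrK mul1r -rE ?loop1.
Qed.

Fact homotopic_refl p : homotopic p p.
Proof.
by apply: (@homotopic_line p p p id id).
Qed.

Fact homotopic_sym p q : homotopic p q -> homotopic q p.
Proof.
move=> [H [cH H0 H1 Hl Hr]].
exists (H \o (fun z => (1 - z.1, z.2))); split => /=.
- apply: (@within_comp (R * R)%type (R * R)%type X I2 I2
    (fun z => (1 - z.1, z.2)) H) => //.
    move=> [s t] /I2P[s01 t01] /=; apply/I2P; split => //.
    by apply/andP; split; lra.
  by apply: continuous_subspaceT; apply: cont_pair => //; exact: contB.
- by move=> t t01; rewrite subr0 H1.
- by move=> t t01; rewrite subrr H0.
- by move=> s s01; rewrite Hl //; apply/andP; split; lra.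
- by move=> s s01; rewrite Hr //; apply/andP; split; lra.
Qed.

Let cont2 (T : topologicalType) (u : T -> R) :
  continuous u -> continuous (fun t => 2 * u t).
Proof. by move=> cu; exact: contM. Qed.

Let cont2B (T : topologicalType) (u : T -> R) :
  continuous u -> continuous (fun t => 2 * u t - 1).
Proof. by move=> cu; apply: contB => //; exact: cont2. Qed.

Fact homotopic_trans q p r : homotopic p q -> homotopic q r -> homotopic p r.
Proof.
move=> [H [cH H0 H1 Hl Hr]] [K [cK K0 K1 Kl Kr]].
exists (fun z => if z.1 <= 2^-1 then (H \o (fun z => (2 * z.1, z.2))) z
                 else (K \o (fun z => (2 * z.1 - 1, z.2))) z); split => /=.
- apply: (@glue _ I2) => //.
  + apply: (@within_comp (R * R)%type (R * R)%type X _ I2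
      (fun z => (2 * z.1, z.2)) H) => //.
      move=> [s t] [/I2P[s01 t01] /= s2]; apply/I2P; split => //.
      by apply/andP; split; lra.
    by apply: continuous_subspaceT; apply: cont_pair => //; exact: cont2.
  + apply: (@within_comp (R * R)%type (R * R)%type X _ I2
      (fun z => (2 * z.1 - 1, z.2)) K) => //.
      move=> [s t] [/I2P[s01 t01] /= s2]; apply/I2P; split => //.
      by apply/andP; split; lra.
    by apply: continuous_subspaceT; apply: cont_pair => //; exact: cont2B.
  + move=> [s t] /I2P[s01 t01] /= ->.
    by rewrite divff // subrr K0 // H1.
- by move=> t t01; rewrite ifT ?mulr0 ?H0 //; lra.
- move=> t t01; rewrite ifF; last by apply/negbTE; rewrite -ltNge; lra.
  by rewrite mulr1 -{2}[1]/(1%:R) (_ : 2 - 1 = 1 :> R) ?K1 //; lra.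
- move=> s s01; case: leP => s2; [rewrite Hl //|rewrite Kl //];
  by apply/andP; split; lra.
- move=> s s01; case: leP => s2; [rewrite Hr //|rewrite Kr //];
  by apply/andP; split; lra.
Qed.

Fact cst_loop_cts : {within `[0, 1 : R], continuous (fun=> x)}.
Proof. by apply: continuous_subspaceT => t; exact: cvg_cst. Qed.

Definition cst_loop : loop x := Loop cst_loop_cts erefl erefl.

Section concatenation.
Variables p q : loop x.

Definition cat_fun (t : R) : X :=
  if t <= 2^-1 then p (2 * t) else q (2 * t - 1).

Fact cat_loop_cts : {within `[0, 1], continuous cat_fun}.
Proof.
apply: (@glue R `[0, 1]%classic id (p \o (fun t => 2 * t))
  (q \o (fun t => 2 * t - 1))) => //.
- apply: (@within_comp R R X _ `[0, 1]%classic (fun t => 2 * t) p);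
    last exact: loop_cts.
    by move=> t [/=]; rewrite !in_itv /= => t01 t2; apply/andP; split; lra.
  by apply: continuous_subspaceT; exact: cont2.
- apply: (@within_comp R R X _ `[0, 1]%classic (fun t => 2 * t - 1) q);
    last exact: loop_cts.
    by move=> t [/=]; rewrite !in_itv /= => t01 t2; apply/andP; split; lra.
  by apply: continuous_subspaceT; exact: cont2B.
- by move=> t _ /= ->; rewrite divff // subrr loop0 loop1.
Qed.

Fact cat_loop0 : cat_fun 0 = x.
Proof. by rewrite /cat_fun ifT ?mulr0 ?loop0 //; lra. Qed.

Fact cat_loop1 : cat_fun 1 = x.
Proof.
rewrite /cat_fun ifF; last by apply/negbTE; rewrite -ltNge; lra.
by rewrite mulr1 (_ : 2 - 1 = 1 :> R) ?loop1 //; lra.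
Qed.

Definition cat_loop : loop x := Loop cat_loop_cts cat_loop0 cat_loop1.

End concatenation.

Section reversal.
Variable p : loop x.

Definition rev_fun (t : R) : X := p (1 - t).

Fact rev_loop_cts : {within `[0, 1], continuous rev_fun}.
Proof.
apply: (@within_comp R R X _ `[0, 1]%classic (fun t => 1 - t) p);
  last exact: loop_cts.
  by move=> t /=; rewrite !in_itv /= => t01; apply/andP; split; lra.
by apply: continuous_subspaceT; exact: contB.
Qed.

Fact rev_loop0 : rev_fun 0 = x.
Proof. by rewrite /rev_fun subr0 loop1. Qed.

Fact rev_loop1 : rev_fun 1 = x.
Proof. by rewrite /rev_fun subrr loop0. Qed.

Definition rev_loop : loop x := Loop rev_loop_cts rev_loop0 rev_loop1.

End reversal.

Fact cat_loop_homotopic p p' q q' :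
  homotopic p p' -> homotopic q q' -> homotopic (cat_loop p q) (cat_loop p' q').
Proof.
move=> [H [cH H0 H1 Hl Hr]] [K [cK K0 K1 Kl Kr]].
exists (fun z => if z.2 <= 2^-1 then (H \o (fun z => (z.1, 2 * z.2))) z
                 else (K \o (fun z => (z.1, 2 * z.2 - 1))) z); split => /=.
- apply: (@glue _ I2) => //.
  + apply: (@within_comp (R * R)%type (R * R)%type X _ I2
      (fun z => (z.1, 2 * z.2)) H) => //.
      move=> [s t] [/I2P[s01 t01] /= s2]; apply/I2P; split => //.
      by apply/andP; split; lra.
    by apply: continuous_subspaceT; apply: cont_pair => //; exact: cont2.
  + apply: (@within_comp (R * R)%type (R * R)%type X _ I2
      (fun z => (z.1, 2 * z.2 - 1)) K) => //.
      move=> [s t] [/I2P[s01 t01] /= s2]; apply/I2P; split => //.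
      by apply/andP; split; lra.
    by apply: continuous_subspaceT; apply: cont_pair => //; exact: cont2B.
  + move=> [s t] /I2P[s01 t01] /= ->.
    by rewrite divff // subrr Hr // Kl.
- move=> t t01; rewrite /cat_fun;
  case: leP => t2; [rewrite H0 //|rewrite K0 //];
  by apply/andP; split; lra.
- move=> t t01; rewrite /cat_fun;
  case: leP => t2; [rewrite H1 //|rewrite K1 //];
  by apply/andP; split; lra.
- by move=> s s01; rewrite ifT ?mulr0 ?Hl //; lra.
- move=> s s01; rewrite ifF; last by apply/negbTE; rewrite -ltNge; lra.
  by rewrite mulr1 (_ : 2 - 1 = 1 :> R) ?Kr //; lra.
Qed.

Fact rev_loop_homotopic p p' :
  homotopic p p' -> homotopic (rev_loop p) (rev_loop p').
Proof.
move=> [H [cH H0 H1 Hl Hr]].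
exists (H \o (fun z => (z.1, 1 - z.2))); split => /=.
- apply: (@within_comp (R * R)%type (R * R)%type X I2 I2
    (fun z => (z.1, 1 - z.2)) H) => //.
    move=> [s t] /I2P[s01 t01] /=; apply/I2P; split => //.
    by apply/andP; split; lra.
  by apply: continuous_subspaceT; apply: cont_pair => //; exact: contB.
- by move=> t t01; rewrite H0 //; apply/andP; split; lra.
- by move=> t t01; rewrite H1 //; apply/andP; split; lra.
- by move=> s s01; rewrite subr0 Hr.
- by move=> s s01; rewrite subrr Hl.
Qed.

Let cmin (u v : R -> R) : continuous u -> continuous v ->
  continuous (fun t => Num.min (u t) (v t)).
Proof. by move=> cu cv t; apply: continuous_min; [exact: cu|exact: cv]. Qed.

Let cmax (u v : R -> R) : continuous u -> continuous v ->
  continuous (fun t => Num.max (u t) (v t)).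
Proof. by move=> cu cv t; apply: continuous_max; [exact: cu|exact: cv]. Qed.

Let caff (a b : R) : continuous (fun t : R => a * t + b).
Proof. by apply: contD => //; exact: contM. Qed.

Fact cat_loopA p q r :
  homotopic (cat_loop p (cat_loop q r)) (cat_loop (cat_loop p q) r).
Proof.
apply/homotopic_sym.
pose phi (t : R) := Num.min (Num.min (2 * t + 0) (1 * t + 4^-1))
                            (2^-1 * t + 2^-1).
apply: (@homotopic_line (cat_loop p (cat_loop q r)) _ _ phi id) => //.
- by apply: cmin; [apply: cmin|]; exact: caff.
- move=> t t01; rewrite /phi; case: (leP (2 * t + 0) (1 * t + 4^-1)) => ?;
  by case: (leP _ (2^-1 * t + 2^-1)) => ?;
  apply/andP; split; lra.
- rewrite /phi; case: (leP (2 * 0 + 0 : R)) => ?; case: leP => ?; lra.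
- rewrite /phi; case: (leP (2 * 1 + 0 : R)) => ?; case: leP => ?; lra.
- move=> t t01; rewrite /= /cat_fun /= /cat_fun /phi.
  case: (leP (2 * t + 0) (1 * t + 4^-1)) => ?;
  case: (leP _ (2^-1 * t + 2^-1)) => ?; repeat case: leP => ?;
  by [exfalso; lra|congr (_ _); lra].
Qed.

Fact cat_loop1l p : homotopic (cat_loop cst_loop p) p.
Proof.
apply: (@homotopic_line p _ _ (fun t => Num.max (2 * t + -1) (0 * t + 0)) id)
  => //.
- by apply: cmax; exact: caff.
- by move=> t t01; case: (leP (2 * t + -1) (0 * t + 0)) => ?;
  apply/andP; split; lra.
- by case: leP => ?; lra.
- by case: leP => ?; lra.
- move=> t t01; rewrite /= /cat_fun /=;
  case: (leP (2 * t + -1) (0 * t + 0)) => ?;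
  case: leP => ?; try (exfalso; lra).
  + by rewrite mul0r addr0 loop0.
  + by congr (p _); lra.
Qed.

Fact cat_loop1r p : homotopic (cat_loop p cst_loop) p.
Proof.
apply: (@homotopic_line p _ _ (fun t => Num.min (2 * t + 0) (0 * t + 1)) id)
  => //.
- by apply: cmin; exact: caff.
- by move=> t t01; case: (leP (2 * t + 0) (0 * t + 1)) => ?;
  apply/andP; split; lra.
- by case: leP => ?; lra.
- by case: leP => ?; lra.
- move=> t t01; rewrite /= /cat_fun /=;
  case: (leP (2 * t + 0) (0 * t + 1)) => ?; case: leP => ?; try (exfalso; lra).
  + by congr (p _); lra.
  + by rewrite mul0r add0r loop1.
Qed.

Fact cat_loopV p : homotopic (cat_loop (rev_loop p) p) cst_loop.
Proof.
apply: (@homotopic_line p _ _ (fun t => Num.max (-2 * t + 1) (2 * t + -1))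
  (fun=> 1)) => //.
- by apply: cmax; exact: caff.
- exact: cont_cst.
- by move=> t t01; case: (leP (-2 * t + 1) (2 * t + -1)) => ?;
  apply/andP; split; lra.
- by move=> t t01; apply/andP; split; lra.
- by case: leP => ?; lra.
- by case: leP => ?; lra.
- move=> t t01; rewrite /= /cat_fun /= /rev_fun.
  by case: (leP (-2 * t + 1) (2 * t + -1)) => ?;
  case: leP => ?; try (exfalso; lra); congr (p _); lra.
- by move=> t _; rewrite loop1.
Qed.

Fact cat_looprV p : homotopic (cat_loop p (rev_loop p)) cst_loop.
Proof.
apply: (@homotopic_line p _ _ (fun t => Num.min (2 * t + 0) (-2 * t + 2))
  (fun=> 0)) => //.
- by apply: cmin; exact: caff.
- exact: cont_cst.
- by move=> t t01; case: (leP (2 * t + 0) (-2 * t + 2)) => ?;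
  apply/andP; split; lra.
- by move=> t t01; apply/andP; split; lra.
- by case: leP => ?; lra.
- by case: leP => ?; lra.
- move=> t t01; rewrite /= /cat_fun /= /rev_fun.
  by case: (leP (2 * t + 0) (-2 * t + 2)) => ?;
  case: leP => ?; try (exfalso; lra); congr (p _); lra.
- by move=> t _; rewrite loop0.
Qed.

Definition loop_pregroup : pregroup :=
  @Pregroup (loop x) homotopic cst_loop rev_loop cat_loop
    homotopic_refl homotopic_sym homotopic_trans
    cat_loop_homotopic rev_loop_homotopic
    cat_loopA cat_loop1l cat_loop1r cat_loopV cat_looprV.

End fundamental_group.

Definition fundamental_group (R : realType) (X : topologicalType) (x : X) :
  groupType := pregroup_quotient (@loop_pregroup R X x).

(* Upper half-plane model of the hyperbolic plane. *)
Section hyperbolic_plane.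
Local Open Scope ring_scope.
Variable R : realType.
Implicit Types z w : R * R.

Definition half_plane : set (R * R) := [set z | 0 < z.2].

Definition arcosh (u : R) : R := ln (u + Num.sqrt (u ^+ 2 - 1)).

Definition hyp_dist z w : R :=
  arcosh (1 + ((z.1 - w.1) ^+ 2 + (z.2 - w.2) ^+ 2) / (2 * z.2 * w.2)).

Definition hyp_ball z (r : R) : set (R * R) :=
  [set w | half_plane w /\ hyp_dist z w < r].

End hyperbolic_plane.

Section hyperbolic_surface.
Local Open Scope ring_scope.
Variable R : realType.

(* Every point is the centre of an open ball isometric to an open ball of the
   hyperbolic plane.                                                          *)
Definition locally_hyperbolic (S : metricType R) : Prop :=
  forall p : S, exists (r : R) (f : S -> R * R),
    [/\ 0 < r, half_plane (f p),
        set_bij (ball p r) (hyp_ball (f p) r) f &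
        forall q q', ball p r q -> ball p r q' ->
          hyp_dist (f q) (f q') = mdist q q'].

(* Closed: compact and without boundary (the latter is part of
   [locally_hyperbolic]).                                                     *)
Definition closed_hyperbolic_surface (S : metricType R) : Prop :=
  [/\ compact [set: S], connected [set: S] & locally_hyperbolic S].

Definition hyperbolic_surface_group (H : groupType) : Prop :=
  exists (S : metricType R) (x : S),
    closed_hyperbolic_surface S /\ isomorphic_groups (fundamental_group R x) H.

End hyperbolic_surface.

(* Main.v *)
Require Import Defs.
From HB Require Import structures.
From mathcomp Require Import all_boot all_order all_algebra generic_quotient.
From mathcomp Require Import monoid.
From mathcomp Require Import all_classical all_reals all_analysis.
From mathcomp Require Import ring lra zify.
Import Order.TTheory GRing.Theory Num.Theory numFieldNormedType.Exports.

Set Implicit Arguments.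
Unset Strict Implicit.
Unset Printing Implicit Defensive.

(**
  Let W be the reflection group of a right-angled hyperbolic pentagon and Gamma
  the subgroup of the words in which every reflection occurs an even number of
  times.  Gamma acts freely on the half-plane, with compact quotient, so the
  quotient is a closed hyperbolic surface; lifting loops gives an injection of
  its fundamental group into Gamma.  A word of Gamma is sent to the graph
  product by reading its letters as y_i, y_i^-1, y_i, ... alternately, where
  y_0, ..., y_3 are nontrivial elements of four consecutive vertex groups of
  the cycle and y_4 is an element of the next vertex group conjugated by a
  product over the remaining vertices (a co-contraction).  Both W on the
  half-plane and the graph product on itself play ping-pong: a nonempty reduced
  word acts nontrivially on either side, hence the two kernels coincide.
*)

(** * Ping-pong for graph products *)

(** The vertex groups may contain no involution, so the reflection group itself need not map to the
    graph product. Even words do: the exponent of a letter tells in which direction a mirror is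
    crossed, the two letters of a cancelling pair get opposite exponents, and [alt_prod] becomes
    multiplicative.

    All information about Gamma is drawn from one dichotomy. An even word cancels either to the
    empty word, and then it acts trivially and has product 1, or to a nonempty reduced word, and
    then it moves every point of the half-plane by at least [gap] and its product is not 1. The
    uniform bound gives freeness, discreteness and an injectivity radius at once; equality of the
    kernels makes the holonomy of a loop both well defined and injective.

    The pentagon is the right-angled hyperbolic polygon with the fewest sides, and contracting a
    path of the cycle reduces every m to it. Gamma has index 32 in the reflection group, so the
    surface is tiled by 32 pentagons and has genus 5. *)

Section graph_product_action.
Variables (V : choiceType) (Gamma : sgraph V) (G : V -> groupType).
Local Open Scope group_scope.

Local Notation GP := (graph_product Gamma G).
Local Notation relators := (normal_closure (@edge_commutators _ Gamma G)).

Definition vertex_elt (v : V) (g : G v) : GP :=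
  pg_pi (fp_inj g : quotient_pregroup relators).

Lemma vertex_eltM v (g h : G v) :
  vertex_elt (g * h) = vertex_elt g * vertex_elt h.
Proof.
rewrite /vertex_elt -pg_piM; congr pg_pi.
rewrite /fp_inj /= -pg_piM; apply/pg_piP/fp_sym => /=.
exact: (@fp_merge _ _ [::] [::]).
Qed.

Lemma vertex_elt1 v : vertex_elt (1 : G v) = 1.
Proof.
by apply: (mulgI (vertex_elt (1 : G v))); rewrite -vertex_eltM !mulg1.
Qed.

Lemma vertex_eltV v (g : G v) : vertex_elt g^-1 = (vertex_elt g)^-1.
Proof.
by apply: (mulgI (vertex_elt g)); rewrite -vertex_eltM !mulgV vertex_elt1.
Qed.

Lemma vertex_eltC u v (g : G u) (h : G v) : Gamma u v ->
  vertex_elt g * vertex_elt h = vertex_elt h * vertex_elt g.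
Proof.
move=> uv; rewrite /vertex_elt -!pg_piM; apply/esym/pg_piP => /= N.
apply; exists u, v, g, h; split=> //.
by rewrite /commg /conjg invgM !mulgA.
Qed.

Definition config := forall v, G v -> int.

Local Open Scope ring_scope.

(* An analogue, for arbitrary vertex groups, of the geometric representation of
   a right-angled Coxeter group: [g] translates the coordinate at [v] and, for
   [u] not adjacent to [v], changes [x u 1] by a multiple of the variation of
   [x v 1].  Any factor at least 2 would do. *)
Definition act_vertex (v : V) (g : G v) (x : config) : config :=
  dfwith (fun u (h : G u) =>
      x u h + if (h == 1%g) && ~~ Gamma u v then 2 * (x v 1%g - x v g^-1%g)
              else 0)
    v (fun h : G v => x v (g^-1 * h)%g).

Arguments act_vertex {v} g x _ _.

Lemma act_vertexE v (g : G v) x h : act_vertex g x v h = x v (g^-1 * h)%g.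
Proof. by rewrite /act_vertex dfwithin. Qed.

Lemma act_vertex_other u v (g : G v) x (h : G u) : u != v ->
  act_vertex g x u h
  = x u h + if (h == 1%g) && ~~ Gamma u v then 2 * (x v 1%g - x v g^-1%g)
            else 0.
Proof. by move=> uv; rewrite /act_vertex dfwithout 1?eq_sym. Qed.

Lemma act_vertex_adj u v (g : G v) x (h : G u) : Gamma u v ->
  act_vertex g x u h = x u h.
Proof.
move=> uv; rewrite act_vertex_other ?uv ?andbF ?addr0//.
by apply: contraTneq uv => ->; rewrite adj_irr.
Qed.

Lemma config_eq (x y : config) : (forall v h, x v h = y v h) -> x = y.
Proof.
by move=> xy; apply: functional_extensionality_dep => v; apply/funext => h.
Qed.

Lemma act_vertex1 v x : act_vertex (1%g : G v) x = x.
Proof.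
apply: config_eq => u; have [->|uv] := eqVneq u v => h.
  by rewrite act_vertexE invg1 mul1g.
by rewrite act_vertex_other// invg1 subrr mulr0 if_same addr0.
Qed.

(** The variation [x v 1 - x v g^-1] is a cocycle in [g]: the increments received at the other
    vertices telescope. *)
Lemma act_vertexM v (g h : G v) x :
  act_vertex (g * h)%g x = act_vertex g (act_vertex h x).
Proof.
apply: config_eq => u; have [->|uv] := eqVneq u v => k.
  by rewrite !act_vertexE invgM mulgA.
rewrite !(act_vertex_other _ _ _ uv) !act_vertexE -addrA mulg1 invgM.
by congr (_ + _); case: ifP => // _; rewrite -mulrDr addrA subrK.
Qed.

Lemma act_vertexC u v (g : G u) (h : G v) x : Gamma u v ->
  act_vertex g (act_vertex h x) = act_vertex h (act_vertex g x).
Proof.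
move=> uv; have vu : Gamma v u by rewrite adj_sym.
apply: config_eq => w; have [->|wu] := eqVneq w u => [k|].
  by rewrite act_vertexE !(act_vertex_adj _ _ _ uv) act_vertexE.
have [->|wv] := eqVneq w v => k.
  by rewrite act_vertexE !(act_vertex_adj _ _ _ vu) act_vertexE.
rewrite (act_vertex_other _ _ _ wu) (act_vertex_other _ _ _ wv).
rewrite (act_vertex_other _ _ _ wv) (act_vertex_other _ _ _ wu).
by rewrite !(act_vertex_adj _ _ _ uv) !(act_vertex_adj _ _ _ vu) addrAC.
Qed.

Definition act_syllable (s : syllable G) : config -> config :=
  act_vertex (tagged s).

Definition act_word (w : fp_word G) (x : config) : config :=
  foldr act_syllable x w.

Lemma act_word_cat w w' x : act_word (w ++ w') x = act_word w (act_word w' x).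
Proof. by rewrite /act_word foldr_cat. Qed.

Lemma act_word_eqv w w' x : fp_eqv w w' -> act_word w x = act_word w' x.
Proof.
elim=> {w w'} //.
- by move=> w2 w1 w3 _ -> _ ->.
- by move=> w w' v g h; rewrite !act_word_cat /= /act_syllable /= act_vertexM.
- by move=> w w' v; rewrite !act_word_cat /= /act_syllable /= act_vertex1.
Qed.

Definition act_free (a : free_product G) : config -> config :=
  act_word (pg_repr a).

Lemma act_free_pi (w : fp_word G) x :
  act_free (pg_pi (w : free_product_pregroup G)) x = act_word w x.
Proof. exact/act_word_eqv/(pg_repr_pi (w : free_product_pregroup G)). Qed.

Lemma act_free1 x : act_free 1%g x = x.
Proof. exact: act_free_pi [::] x. Qed.

Lemma act_freeM a b x : act_free (a * b)%g x = act_free a (act_free b x).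
Proof.
rewrite -[a]pg_reprK -[b]pg_reprK -pg_piM act_free_pi !act_free_pi.
exact: act_word_cat.
Qed.

Lemma act_freeVK a x : act_free a^-1%g (act_free a x) = x.
Proof. by rewrite -act_freeM mulVg act_free1. Qed.

Lemma act_freeKV a x : act_free a (act_free a^-1%g x) = x.
Proof. by rewrite -act_freeM mulgV act_free1. Qed.

Definition act_kernel : normal_subgroup (free_product G).
Proof.
apply: (@NormalSubgroup _ (fun a => forall x, act_free a x = x)).
- exact: act_free1.
- by move=> a b ha hb x; rewrite act_freeM hb.
- by move=> a ha x; rewrite -{2}[x](act_freeVK a) ha.
- by move=> a b ha x; rewrite /conjg !act_freeM ha act_freeVK.
Defined.

Lemma act_fp_inj v (g : G v) x : act_free (fp_inj g) x = act_vertex g x.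
Proof. exact: act_free_pi. Qed.

Lemma act_edge_commutators a : edge_commutators Gamma a -> act_kernel a.
Proof.
move=> [u [v [g [h [uv ->]]]]] /= x; rewrite /commg /conjg !act_freeM.
rewrite !act_fp_inj [act_vertex g _]act_vertexC// -!act_fp_inj.
by rewrite act_freeVK act_freeVK.
Qed.

Definition act (a : GP) : config -> config := act_free (pg_repr a).

Lemma act_pi (a : free_product G) x :
  act (pg_pi (a : quotient_pregroup relators)) x = act_free a x.
Proof.
set P := quotient_pregroup _; have := pg_repr_pi (a : P).
move=> /(_ act_kernel act_edge_commutators x); rewrite /= act_freeM.
by move=> /(congr1 (act_free (pg_repr (pg_pi (a : P))))); rewrite act_freeKV.
Qed.

Lemma act1 x : act 1%g x = x.
Proof. by rewrite -[1%g]/(pg_pi _) act_pi act_free1. Qed.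

Lemma actM a b x : act (a * b)%g x = act a (act b x).
Proof.
by rewrite -[a]pg_reprK -[b]pg_reprK -pg_piM act_pi !act_pi act_freeM.
Qed.

Lemma act_vertex_elt v (g : G v) x : act (vertex_elt g) x = act_vertex g x.
Proof. by rewrite act_pi act_fp_inj. Qed.

Definition dominant (v : V) (x : config) : Prop :=
  forall h : G v, h != 1%g -> x v h < x v 1%g.

(** A quantitative form, stable under induction, of the fact that two non-adjacent vertices are
    never both non-dominant. *)
Definition balanced (x : config) : Prop :=
  forall u v (h : G u) (k : G v), u != v -> ~~ Gamma u v ->
  h != 1%g -> k != 1%g -> 0 < x u 1%g - x u h + (x v 1%g - x v k).

Definition base_config : config := fun v h => (h == 1%g)%:Z.

(** Steps are restricted to dominant vertices, where they lengthen the normal form, because such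
    steps preserve [balanced]; [reachable_act] then shows that arbitrary steps stay inside. *)
Inductive reachable : config -> Prop :=
| reachable_base : reachable base_config
| reachable_step v (g : G v) x :
    g != 1%g -> dominant v x -> reachable x -> reachable (act_vertex g x).

Lemma balanced_dominant x u v : balanced x -> u != v -> ~~ Gamma u v ->
  dominant u x \/ dominant v x.
Proof.
move=> bx uv nuv; have [|nu] := pselect (dominant u x); [by left|right=> k k1].
move: nu => /existsNP[h /not_implyP[h1 /negP]]; rewrite -leNgt => uh.
by have := bx u v h k uv nuv h1 k1; lia.
Qed.

Lemma step_not_dominant v (g : G v) x :
  g != 1%g -> dominant v x -> ~ dominant v (act_vertex g x).
Proof.
move=> g1 dx /(_ g g1); rewrite !act_vertexE mulVg mulg1 => xg.
by have := dx g^-1%g; rewrite invg_eq1 => /(_ g1) /(lt_trans xg); rewrite ltxx.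
Qed.

Lemma balanced_step v (g : G v) x :
  g != 1%g -> dominant v x -> balanced x -> balanced (act_vertex g x).
Proof.
move=> g1 dx bx.
have gV1 : g^-1%g != 1%g by rewrite invg_eq1.
have dg : 0 < x v 1%g - x v g^-1%g by rewrite subr_gt0 dx.
have le1 k : x v k <= x v 1%g.
  by have [->//|k1] := eqVneq k 1%g; exact/ltW/dx.
have gain u (h : G u) : u != v -> h != 1%g ->
    x u 1%g - x u h <= act_vertex g x u 1%g - act_vertex g x u h.
  move=> uv h1; rewrite !(act_vertex_other _ _ _ uv) (negPf h1) eqxx /=.
  case: ifP => _; lia.
(* At [v] the new difference can be as low as [- (x v 1 - x v g^-1)]. The factor 2 pays for this
   loss and leaves one more copy, which the old balance of [h] against [g^-1] requires. *)
have main u (h : G u) (k : G v) : u != v -> ~~ Gamma u v ->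
    h != 1%g -> k != 1%g ->
    0 < act_vertex g x u 1%g - act_vertex g x u h +
        (act_vertex g x v 1%g - act_vertex g x v k).
  move=> uv nuv h1 k1; rewrite !(act_vertex_other _ _ _ uv) (negPf h1) eqxx nuv.
  rewrite /= !act_vertexE mulg1 addr0.
  have := bx _ _ h _ uv nuv h1 gV1; have := le1 (g^-1 * k)%g.
  by move: dg; lia.
move=> u w h k uw nuw h1 k1.
have [wv|wv] := eqVneq w v; first by subst w; exact: main.
have [uv|uv] := eqVneq u v.
  by subst u; rewrite addrC; apply: main => //; rewrite 1?eq_sym// adj_sym.
have := gain _ _ uv h1; have := gain _ _ wv k1.
by have := bx _ _ _ _ uw nuw h1 k1; lia.
Qed.

Lemma reachable_balanced x : reachable x -> balanced x.
Proof.
elim=> [u v h k _ _ h1 k1|v g {}x g1 dx _]; last exact: balanced_step.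
by rewrite /base_config !eqxx (negPf h1) (negPf k1).
Qed.

Lemma adj_dominant u v (g : G u) x : Gamma u v ->
  dominant v (act_vertex g x) <-> dominant v x.
Proof.
rewrite adj_sym => vu; split=> dx h h1; have := dx h h1;
  by rewrite !(act_vertex_adj _ _ _ vu).
Qed.

(** Induction on the last step, taken at [u]. If [v] is not dominant after it, either [u = v] and
    the syllables merge, or they commute and the induction hypothesis applies underneath; otherwise
    [balanced] would make [u] dominant right after a step at [u]. *)
Lemma reachable_act v (g : G v) x : reachable x -> reachable (act_vertex g x).
Proof.
have [->|g1] := eqVneq g 1%g; first by rewrite act_vertex1.
have step y : dominant v y -> reachable y -> reachable (act_vertex g y).
  by move=> dy ry; exact: reachable_step.
elim=> [|u h {}x h1 dx rx IH].
  apply: step; last exact: reachable_base.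
  by move=> h h1; rewrite /base_config eqxx (negPf h1).
have ry : reachable (act_vertex h x) by exact: reachable_step.
have [dy|ndy] := pselect (dominant v (act_vertex h x)); first exact: step.
have [uv|uv] := eqVneq u v.
  subst u; rewrite -act_vertexM; have [->|gh1] := eqVneq (g * h)%g 1%g.
    by rewrite act_vertex1.
  exact: reachable_step.
have [Guv|nGuv] := boolP (Gamma u v).
  rewrite -act_vertexC//; apply: reachable_step => //.
  by apply/adj_dominant => //; rewrite adj_sym.
by case: (balanced_dominant (reachable_balanced ry) uv nGuv) => //;
  move/(step_not_dominant h1 dx).
Qed.

Lemma reachable_word w x : reachable x -> reachable (act_word w x).
Proof. by move=> rx; elim: w => //= s w; exact: reachable_act. Qed.

(* In terms of normal forms: [a] does not start with a syllable in [G v]. *)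
Definition no_head (v : V) (a : GP) : Prop := dominant v (act a base_config).

Lemma no_head1 v : no_head v 1%g.
Proof.
by rewrite /no_head act1 => h h1; rewrite /base_config eqxx (negPf h1).
Qed.

Lemma no_head_mul v (g : G v) a : g != 1%g -> no_head v a ->
  ~ no_head v (vertex_elt g * a)%g.
Proof. by rewrite /no_head actM act_vertex_elt; exact: step_not_dominant. Qed.

Lemma no_head_adj u v (g : G u) a : Gamma u v ->
  no_head v (vertex_elt g * a)%g <-> no_head v a.
Proof. by rewrite /no_head actM act_vertex_elt; exact: adj_dominant. Qed.

Lemma no_head_nonadj u v a : u != v -> ~~ Gamma u v ->
  no_head u a \/ no_head v a.
Proof.
exact/balanced_dominant/reachable_balanced/reachable_word/reachable_base.
Qed.

End graph_product_action.

(** * Words in a right-angled Coxeter group *)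

Section coxeter_words.
Variables (L : eqType) (comm : rel L).
Hypothesis comm_irr : irreflexive comm.
Implicit Types (i j : L) (u v w : seq L).

Definition reduced w : Prop :=
  forall a b c i, w = a ++ i :: b ++ i :: c -> ~~ all (comm i) b.

Definition even_word w : Prop := forall i, ~~ odd (count_mem i w).

Lemma reduced_cons i u : reduced (i :: u) -> reduced u.
Proof. by move=> red a b c k e; apply: (red (i :: a) b c); rewrite e. Qed.

Lemma reduced_drop2 i j u : comm i j -> reduced [:: i, j & u] ->
  reduced (i :: u).
Proof.
move=> ij red [|k a] b c l /= [].
  by move=> <- e; have := red [::] (j :: b) c i; rewrite e /= ij; apply.
by move=> _ e; apply: (red [:: i, j & a] b c l); rewrite /= e.
Qed.

Lemma reduced_head_neq i u : ~ reduced [:: i, i & u].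
Proof. by move=> /(_ [::] [::] u i erefl). Qed.

Inductive cancels : seq L -> seq L -> Prop :=
| cancels_refl w : cancels w w
| cancels_step a b c i v : all (comm i) b -> cancels (a ++ b ++ c) v ->
    cancels (a ++ i :: b ++ i :: c) v.

Lemma cancels_reduced w : exists2 v, reduced v & cancels w v.
Proof.
have [n] := ubnP (size w); elim: n w => // n IH w wn.
have [|nred] := pselect (reduced w).
  by exists w => //; exact: cancels_refl.
have [a [b [c [i [e hb]]]]] :
    exists a b c i, w = a ++ i :: b ++ i :: c /\ all (comm i) b.
  apply: contrapT => h; apply: nred => a b c i e; apply/negP => hb.
  by apply: h; exists a, b, c, i.
have [|v rv cv] := IH (a ++ b ++ c).
  by move: wn; rewrite e !size_cat /= !size_cat /= !addnS => /ltnW.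
by exists v => //; rewrite e; exact: cancels_step.
Qed.

Lemma odd_count_cancel a b c i j :
  odd (count_mem j (a ++ i :: b ++ i :: c)) = odd (count_mem j (a ++ b ++ c)).
Proof.
rewrite count_cat /= count_cat /= !count_cat !oddD; congr (_ (+) _).
by rewrite addbCA addKb.
Qed.

Lemma cancels_even w v : cancels w v -> even_word w -> even_word v.
Proof.
elim=> // a b c i {}v _ _ IH ew; apply: IH => j.
by rewrite -(odd_count_cancel _ _ _ i).
Qed.

Section ping_pong.
Variables Out In : L -> seq L -> Prop.
Hypothesis Out_nil : forall i, Out i [::].
Hypothesis Out_In : forall i u, Out i u -> In i (i :: u).
Hypothesis Out_comm : forall i j u, comm i j -> Out i u -> Out i (j :: u).
Hypothesis In_Out :
  forall i j u, i != j -> ~~ comm i j -> In j (j :: u) -> Out i (j :: u).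

(** A head of [u] that commutes with [i] can be skipped, since dropping it keeps the word reduced.
    The first head [j] that does not commute puts the position into [In j], which lies in
    [Out i]. *)
Lemma ping_pong i u : reduced (i :: u) -> Out i u.
Proof.
elim: u i => [//|j u IH] i red.
have [ij|ij] := boolP (comm i j).
  exact/Out_comm/IH/(reduced_drop2 ij).
have [eij|nij] := eqVneq i j; first by subst j; case: (reduced_head_neq red).
by apply: In_Out => //; exact/Out_In/IH/(reduced_cons red).
Qed.

(** [Far] is a quantitative [Out]. It may fail at the base position, but a single letter of [u] not
    commuting with [i] is enough to reach it. *)
Lemma ping_pong_strict (Far : L -> seq L -> Prop) i u :
  (forall i j u, comm i j -> Far i u -> Far i (j :: u)) ->
  (forall i j u, i != j -> ~~ comm i j -> In j (j :: u) -> Far i (j :: u)) ->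
  reduced (i :: u) -> ~~ all (comm i) u -> Far i u.
Proof.
move=> Far_comm In_Far; elim: u => [//|j u IH] red /=.
have [ij /= ni|ij _] := boolP (comm i j).
  by apply: Far_comm => //; apply: IH => //; exact: reduced_drop2 red.
have [eij|nij] := eqVneq i j; first by subst j; case: (reduced_head_neq red).
by apply: In_Far => //; exact/Out_In/ping_pong/(reduced_cons red).
Qed.

End ping_pong.

(** By parity [i] occurs again in [u], and no letter commutes with itself. This provides the letter
    that [ping_pong_strict] asks for. *)
Lemma even_head i u : even_word (i :: u) -> ~~ all (comm i) u.
Proof.
move=> /(_ i); rewrite /= eqxx oddD /= negbK => /odd_gt0.
rewrite -has_count => /hasP[j ju /eqP eji]; apply/allPn; exists j => //.
by rewrite eji comm_irr.
Qed.

Section alternating_product.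
Local Open Scope group_scope.
Variables (H : groupType) (y : L -> H).
Hypothesis yC : forall i j, comm i j -> y i * y j = y j * y i.

Definition signed (b : bool) (h : H) : H := if b then h^-1 else h.

(* The exponents of [y i] alternate: they record the side from which a mirror
   is crossed, for an orientation of the mirrors invariant under even words. *)
Fixpoint alt_prod w : H :=
  if w is i :: u then signed (odd (count_mem i u)) (y i) * alt_prod u else 1.

Lemma signedC b b' i j : comm i j ->
  signed b (y i) * signed b' (y j) = signed b' (y j) * signed b (y i).
Proof.
move=> /yC e; have cV (g h : H) : g * h = h * g -> g * h^-1 = h^-1 * g.
  by move=> gh; apply: (mulgI h); rewrite mulVKg mulgA -gh mulgK.
by case: b; case: b' => //=;
  [apply/cV/esym/cV/esym|apply/esym/cV/esym|apply/cV].
Qed.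

Lemma alt_prod_mid b i c : all (comm i) b ->
  alt_prod (b ++ i :: c)
  = signed (odd (count_mem i c)) (y i) * alt_prod (b ++ c).
Proof.
elim: b => [//|j b IH] /= /andP[ij hb]; rewrite IH// !mulgA.
have ji : (i == j) = false by apply/negP => /eqP e; rewrite e comm_irr in ij.
by rewrite -(signedC _ _ ij) !count_cat /= ji.
Qed.

(** As [b] contains no [i], the two occurrences carry opposite exponents; removing both leaves all
    other parities unchanged. *)
Lemma alt_prod_cancel a b c i : all (comm i) b ->
  alt_prod (a ++ i :: b ++ i :: c) = alt_prod (a ++ b ++ c).
Proof.
move=> hb; elim: a => [|j a IH] /=; last by rewrite IH odd_count_cancel.
rewrite alt_prod_mid// mulgA count_cat oddD /= eqxx.
have -> : count_mem i b = 0%N.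
  apply/count_memPn/negP => /(allP hb); by rewrite comm_irr.
by rewrite /signed /=; case: odd => /=; rewrite (mulgV, mulVg) mul1g.
Qed.

Lemma alt_prod_cancels w v : cancels w v -> alt_prod w = alt_prod v.
Proof. by elim=> // a b c i {}v hb _ <-; exact: alt_prod_cancel. Qed.

(** The exponents of [u] inside [u ++ w] are shifted by the parities of [w], which is why the right
    factor must be even. *)
Lemma alt_prod_cat u w : even_word w ->
  alt_prod (u ++ w) = alt_prod u * alt_prod w.
Proof.
move=> ew; elim: u => [|i u IH] /=; first by rewrite mul1g.
by rewrite IH count_cat oddD (negPf (ew i)) addbF mulgA.
Qed.

End alternating_product.
End coxeter_words.

Variant letter := L0 | L1 | L2 | L3 | L4.

Definition letter_code (l : letter) : nat :=
  match l with L0 => 0 | L1 => 1 | L2 => 2 | L3 => 3 | L4 => 4 end.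

Lemma letter_code_inj : injective letter_code.
Proof. by do 2!case. Qed.

HB.instance Definition _ := Equality.copy letter (inj_type letter_code_inj).

(* Perpendicular sides of the pentagon: indices at distance 2 modulo 5, so that
   non-perpendicular sides correspond to adjacent vertices of the cycle. *)
Definition perp : rel letter := fun i j =>
  match i, j with
  | L0, (L2 | L3) | L1, (L3 | L4) | L2, (L4 | L0) | L3, (L0 | L1)
  | L4, (L1 | L2) => true
  | _, _ => false
  end.

Lemma perp_irr : irreflexive perp.
Proof. by case. Qed.

Lemma perp_sym : symmetric perp.
Proof. by do 2!case. Qed.

Section commutation.
Local Open Scope group_scope.
Variable H : groupType.
Implicit Types x y z : H.

Lemma commuteV x y : x * y = y * x -> x * y^-1 = y^-1 * x.
Proof. by move=> e; apply: (mulgI y); rewrite mulVKg mulgA -e mulgK. Qed.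

Lemma commuteM x y z : x * y = y * x -> x * z = z * x ->
  x * (y * z) = y * z * x.
Proof. by move=> xy xz; rewrite mulgA xy -mulgA xz mulgA. Qed.

End commutation.

(** * Co-contraction: the pentagon elements of the graph product *)

Section pentagon_in_graph_product.
Variables (n : nat) (n4 : (4 <= n)%N) (G : 'I_n.+1 -> groupType).
Variables (g : forall v, G v) (g1 : forall v, g v != 1%g).
Local Open Scope group_scope.

Let Gamma := opp_graph (cycle_graph n.+1).
Local Notation GP := (graph_product Gamma G).

Let V (k : nat) : 'I_n.+1 := inord k.
Let e (k : nat) : GP := vertex_elt Gamma (g (V k)).

Let eq_V j k : (j <= n)%N -> (k <= n)%N -> (V j == V k) = (j == k).
Proof. by move=> jn kn; rewrite -val_eqE /= !inordK. Qed.

Let V_ordS j k : (j <= n)%N -> (k <= n)%N ->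
  (V j == ordS (V k)) = (j == if k == n then 0%N else k.+1).
Proof.
move=> jn kn; rewrite -val_eqE /= !inordK//.
by have [->|kn'] := eqVneq k n; rewrite ?modnn// modn_small//; lia.
Qed.

Let adjE j k : (j <= n)%N -> (k <= n)%N ->
  Gamma (V j) (V k) = [&& j != k, k != j.+1, j != k.+1,
                         (j, k) != (0, n)%N & (j, k) != (n, 0)%N].
Proof.
move=> jn kn; rewrite /Gamma /= /opp_adj /= /cycle_adj eq_V// !V_ordS//.
rewrite !xpair_eqE.
by have [->|kn'] := eqVneq k n; have [->|jn'] := eqVneq j n; apply/idP/idP; lia.
Qed.

Let tail k d : GP := foldr (fun j p => e j * p) 1 (iota k d).
(** The product over 5, ..., n, the vertices strictly between 4 and 0 on the cycle; it is 1 when m =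
    5. *)
Let B : GP := tail 5 (n - 4).

(* After conjugation by [B] the element at 4 still commutes with those at 1 and
   2: the path [4, ..., n] of the cycle is contracted to a single vertex, with
   neighbours 3 and 0 in the cycle. *)
Definition pentagon_elt (l : letter) : GP :=
  if l is L4 then B^-1 * e 4 * B else e (letter_code l).

Let fixes v (h : GP) := forall a, no_head v (h * a) <-> no_head v a.

Let fixesM v h h' : fixes v h -> fixes v h' -> fixes v (h * h').
Proof.
move=> fh fh' a; rewrite -mulgA; split=> [/fh/fh'//|ha]; exact/fh/fh'.
Qed.

Let fixesV v h : fixes v h -> fixes v h^-1.
Proof. by move=> fh a; split=> [/fh|ha]; last apply/fh; rewrite mulVKg. Qed.

Let fixes_e j k : (j <= n)%N -> (k <= n)%N -> Gamma (V k) (V j) ->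
  fixes (V j) (e k).
Proof. by move=> jn kn kj a; exact: no_head_adj. Qed.

Let tail_ind (Q : GP -> Prop) k d : Q 1 ->
  (forall j p, (k <= j < k + d)%N -> Q p -> Q (e j * p)) -> Q (tail k d).
Proof.
move=> Q1 QM; rewrite /tail; elim: d k QM => //= d IH k QM.
apply: (QM k); first lia.
by apply: IH => j p kj; apply: QM; lia.
Qed.

Let fixes_B j : (j \in [:: 1; 2; 3])%N -> fixes (V j) B.
Proof.
move=> j123; apply: tail_ind => [a|k p kn]; first by rewrite mul1g.
apply: fixesM; move: j123; rewrite !inE => j123.
by apply: fixes_e; rewrite ?adjE//; rewrite ?xpair_eqE; lia.
Qed.

Let comm_B j : (j \in [:: 1; 2])%N -> e j * B = B * e j.
Proof.
move=> j12; apply: (@tail_ind (fun b => e j * b = b * e j)) => [|k p kn ep].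
  by rewrite mul1g mulg1.
apply: commuteM => //; apply: vertex_eltC; move: j12; rewrite !inE => j12.
by rewrite adjE//; rewrite ?xpair_eqE; lia.
Qed.

(** A chain reaction along n, n - 1, ..., k: multiplying by [e j] an element without head at [V j]
    creates that head, which excludes one at the cycle neighbour [V j.-1]. The equation
    [k + d = n.+1] makes the tail end exactly at [n]. *)
Let head_tail d k a : (0 < k)%N -> (k + d = n.+1)%N -> no_head (V n) a ->
  no_head (V k.-1) (tail k d * a).
Proof.
elim: d k => [|d IH] k k0 kd ha.
  by rewrite mul1g -[k](@addn0 k) kd.
have kn : (k <= n)%N by lia.
have := IH k.+1 isT _ ha; rewrite addSnnS /= => /(_ kd) {}IH.
rewrite /tail /= -mulgA -/(tail _ _).
have [] // := @no_head_nonadj _ Gamma G (V k) (V k.-1)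
    (e k * (tail k.+1 d * a)).
- by rewrite eq_V//; lia.
- by rewrite adjE//; lia.
- by move/(no_head_mul (g1 _) IH).
Qed.

(** The [Out] regions of the ping-pong. For [L4] the region belonging to [e 4] is translated by
    [B^-1], to match the conjugation. *)
Let P (l : letter) (a : GP) : Prop :=
  if l is L4 then no_head (V 4) (B * a) else no_head (V (letter_code l)) a.

Let P1 l : P l 1.
Proof.
case: l; rewrite /P; try exact: no_head1.
by apply: (@head_tail _ 5) => //; [lia|exact: no_head1].
Qed.

Let signed_e b k : signed b (e k) = vertex_elt Gamma (signed b (g (V k))).
Proof. by case: b => //=; rewrite vertex_eltV. Qed.

Let no_head_e b k a : no_head (V k) a -> ~ no_head (V k) (signed b (e k) * a).
Proof.
rewrite signed_e; apply: no_head_mul.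
by case: b; rewrite /= ?invg_eq1 g1.
Qed.

Let P_mul b l a : P l a -> ~ P l (signed b (pentagon_elt l) * a).
Proof.
case: l; rewrite /P /=; last first.
  suff -> : B * (signed b (B^-1 * e 4 * B) * a) = signed b (e 4) * (B * a).
    exact: no_head_e.
  by case: b; rewrite /= ?invgM ?invgK !mulgA mulgV mul1g.
all: exact: no_head_e.
Qed.

Let P_comm b i j a : perp i j -> P i a -> P i (signed b (pentagon_elt j) * a).
Proof.
have fix_signed b' v h : fixes v h -> fixes v (signed b' h).
  by case: b' => // /fixesV.
have fix4 k : (k \in [:: 1; 2])%N -> fixes (V k) (pentagon_elt L4).
  rewrite !inE => k12 /=; have fB : fixes (V k) B.
    by apply: fixes_B; rewrite !inE; lia.
  apply: fixesM => //; apply: fixesM; first exact: fixesV.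
  by apply: fixes_e; rewrite ?adjE//; rewrite ?xpair_eqE; lia.
have fix4' k : (k \in [:: 1; 2])%N -> no_head (V 4) (B * a) ->
    no_head (V 4) (B * (signed b (e k) * a)).
  move=> k12 ha; have -> : B * (signed b (e k) * a) = signed b (e k) * (B * a).
    rewrite !mulgA; congr (_ * _); have := comm_B k12.
    by case: (b) => //= /esym/commuteV.
  apply/fix_signed => //; move: k12; rewrite !inE => k12.
  by apply: fixes_e; rewrite ?adjE//; rewrite ?xpair_eqE; lia.
case: i; case: j => // _; rewrite /P /pentagon_elt /letter_code.
1-3, 5, 7-8: by move=> ha; apply/fix_signed => //; apply: fixes_e;
  rewrite ?adjE//; rewrite ?xpair_eqE; lia.
1-2: by move=> ha; apply/fix_signed => //; exact: fix4.
all: exact: fix4'.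
Qed.

Let P_noncomm i j a : i != j -> ~~ perp i j -> P i a \/ P j a.
Proof.
have dich j' k : (j' < k <= n)%N -> ~~ Gamma (V j') (V k) ->
    no_head (V j') a \/ no_head (V k) a.
  by move=> jk; apply: no_head_nonadj; rewrite eq_V; lia.
(* For m > 5 the vertices 0 and 4 are not neighbours on the cycle; the exclusion passes from 0 to
   its neighbour [n] and then travels along the tail down to 4. *)
have d40 : no_head (V 0) a \/ no_head (V 4) (B * a).
  have n0 : (0 < n <= n)%N by lia.
  have nG0 : ~~ Gamma (V 0) (V n) by rewrite adjE//; rewrite ?xpair_eqE; lia.
  have [ha|ha] := dich _ _ n0 nG0; first by left.
  by right; apply: (@head_tail _ 5) => //; lia.
have d43 : no_head (V 3) a \/ no_head (V 4) (B * a).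
  have V34 : V 3 != V 4 by rewrite eq_V; lia.
  have nG34 : ~~ Gamma (V 3) (V 4) by rewrite adjE; lia.
  have [/fixes_B ha|] := no_head_nonadj (B * a) V34 nG34; last by right.
  by left; apply: ha.
have [d01 d12 d23] : [/\ no_head (V 0) a \/ no_head (V 1) a,
    no_head (V 1) a \/ no_head (V 2) a & no_head (V 2) a \/ no_head (V 3) a].
  by split; apply: dich; rewrite ?adjE; lia.
by case: i; case: j => // _ _; rewrite /P /letter_code; tauto.
Qed.

Lemma pentagon_eltC i j : perp i j ->
  pentagon_elt i * pentagon_elt j = pentagon_elt j * pentagon_elt i.
Proof.
have eC j' k : (j' <= n)%N -> (k <= n)%N -> Gamma (V j') (V k) ->
    e j' * e k = e k * e j'.
  by move=> _ _; exact: vertex_eltC.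
have e4 k : (k \in [:: 1; 2])%N ->
    e k * (B^-1 * e 4 * B) = B^-1 * e 4 * B * e k.
  move=> k12; have kB := comm_B k12; apply: commuteM => //.
  apply: commuteM; first exact: commuteV.
  move: k12; rewrite !inE => k12.
  by apply: eC; rewrite ?adjE//; rewrite ?xpair_eqE; lia.
case: i; case: j => // _; rewrite /pentagon_elt /letter_code.
all: try by apply: eC; rewrite ?adjE//; rewrite ?xpair_eqE; lia.
all: try exact: e4.
all: by apply/esym/e4.
Qed.

Lemma pentagon_elt_faithful w : reduced perp w -> w <> [::] ->
  alt_prod pentagon_elt w <> 1.
Proof.
case: w => // i u red _ e1; pose Out i u := P i (alt_prod pentagon_elt u).
(* The product of [i :: u] then violates [P i], whereas 1 satisfies it. *)
suff hi : Out i u.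
  by apply: (P_mul (b := odd (count_mem i u)) hi); rewrite [_ * _]e1; exact: P1.
apply: (@ping_pong _ perp Out (fun i u => ~ Out i u)) red.
- by move=> ?; exact: P1.
- by move=> k v; exact: P_mul.
- by move=> k l v kl; exact: P_comm.
- move=> k l v kl nkl nl.
  by case: (P_noncomm (alt_prod pentagon_elt (l :: v)) kl nkl).
Qed.

End pentagon_in_graph_product.


(** * The right-angled pentagon *)

Section arcosh.
Local Open Scope ring_scope.
Variable R : realType.
Implicit Types a b u v : R.

Lemma sqrt_sqrB1 u : 1 <= u -> Num.sqrt (u ^+ 2 - 1) ^+ 2 = u ^+ 2 - 1.
Proof.
by move=> u1; rewrite sqr_sqrtr// subr_ge0 expr_ge1// (le_trans ler01).
Qed.

Let arcosh_arg_gt0 u : 1 <= u -> 0 < u + Num.sqrt (u ^+ 2 - 1).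
Proof. by move=> u1; rewrite ltr_pwDl ?sqrtr_ge0//; lra. Qed.

Let sqrt_sqrB1_le u v : 1 <= u -> u <= v ->
  Num.sqrt (u ^+ 2 - 1) <= Num.sqrt (v ^+ 2 - 1).
Proof. by move=> u1 uv; rewrite ler_wsqrtr//; nra. Qed.

Lemma arcosh_le u v : 1 <= u -> u <= v -> arcosh u <= arcosh v.
Proof.
move=> u1 uv; have v1 := le_trans u1 uv.
by rewrite /arcosh ler_ln ?posrE ?arcosh_arg_gt0// lerD// sqrt_sqrB1_le.
Qed.

Lemma arcosh_lt u v : 1 <= u -> u < v -> arcosh u < arcosh v.
Proof.
move=> u1 uv; have v1 := le_trans u1 (ltW uv).
rewrite /arcosh ltr_ln ?posrE ?arcosh_arg_gt0// ltr_leD//.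
by rewrite sqrt_sqrB1_le// ltW.
Qed.

Lemma arcosh1 : arcosh (1 : R) = 0.
Proof. by rewrite /arcosh expr1n subrr sqrtr0 addr0 ln1. Qed.

Lemma arcosh_gt0 u : 1 < u -> 0 < arcosh u.
Proof. by move=> u1; rewrite -arcosh1 arcosh_lt. Qed.

Lemma arcoshD a b : 1 <= a -> 1 <= b ->
  arcosh a + arcosh b
  = arcosh (a * b + Num.sqrt (a ^+ 2 - 1) * Num.sqrt (b ^+ 2 - 1)).
Proof.
move=> a1 b1; rewrite {3}/arcosh.
have := sqrt_sqrB1 a1; have := sqrt_sqrB1 b1.
set s := Num.sqrt (a ^+ 2 - 1); set t := Num.sqrt (b ^+ 2 - 1) => t2 s2.
have [s0 t0] : 0 <= s /\ 0 <= t by rewrite !sqrtr_ge0.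
(* Here [a], [b] are hyperbolic cosines and [s], [t] the sines; the right-hand side is the squared
   sine of the sum. *)
have -> : (a * b + s * t) ^+ 2 - 1 = (a * t + b * s) ^+ 2.
  transitivity (a ^+ 2 * b ^+ 2 + 2 * (a * b * s * t) + s ^+ 2 * t ^+ 2 - 1).
    by ring.
  transitivity (a ^+ 2 * t ^+ 2 + 2 * (a * b * s * t) + b ^+ 2 * s ^+ 2).
    by rewrite s2 t2; ring.
  by ring.
rewrite sqrtr_sqr ger0_norm; last by nra.
rewrite /arcosh -/s -/t -lnM ?posrE; try lra.
by congr ln; ring.
Qed.

Lemma arcosh_triangle a b c : 1 <= a -> 1 <= b -> 1 <= c ->
  (c - a * b) ^+ 2 <= (a ^+ 2 - 1) * (b ^+ 2 - 1) ->
  arcosh c <= arcosh a + arcosh b.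
Proof.
move=> a1 b1 c1 h; rewrite arcoshD//; apply: arcosh_le => //.
rewrite addrC -lerBlDr -sqrtrM; last by rewrite subr_ge0 expr_ge1//; lra.
by rewrite (le_trans (ler_norm _))// -sqrtr_sqr ler_wsqrtr.
Qed.

End arcosh.

Section half_plane_geometry.
Local Open Scope ring_scope.
Variable R : realType.
Implicit Types z w : R * R.

Definition coshd z w : R :=
  1 + ((z.1 - w.1) ^+ 2 + (z.2 - w.2) ^+ 2) / (2 * z.2 * w.2).

Lemma coshdC z w : coshd z w = coshd w z.
Proof.
by rewrite /coshd mulrAC -(sqrrN (z.1 - _)) -(sqrrN (z.2 - _)) !opprB.
Qed.

Lemma coshd_ge1 z w : 0 < z.2 -> 0 < w.2 -> 1 <= coshd z w.
Proof.
move=> z0 w0; rewrite /coshd lerDl divr_ge0 ?addr_ge0 ?sqr_ge0//.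
by rewrite !mulr_ge0// ltW.
Qed.

Lemma coshdxx z : coshd z z = 1.
Proof. by rewrite /coshd !subrr expr0n /= addr0 mul0r addr0. Qed.

Lemma coshd_eq1 z w : 0 < z.2 -> 0 < w.2 -> coshd z w = 1 -> z = w.
Proof.
case: z w => [x y] [x' y'] /= y0 y0' /eqP.
have D0 : 2 * y * y' != 0 by rewrite gt_eqF// !mulr_gt0.
rewrite /coshd /= -subr_eq0 addrC addKr mulf_eq0 invr_eq0 (negPf D0) orbF.
rewrite paddr_eq0 ?sqr_ge0// !sqrf_eq0 !subr_eq0.
by case/andP => /eqP-> /eqP->.
Qed.

Lemma coshd_triangle z w v : 0 < z.2 -> 0 < w.2 -> 0 < v.2 ->
  (coshd z v - coshd z w * coshd w v) ^+ 2
  <= (coshd z w ^+ 2 - 1) * (coshd w v ^+ 2 - 1).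
Proof.
case: z w v => [x y] [x' y'] [x'' y''] /= y0 y0' y0''.
rewrite -subr_ge0 /coshd /=.
(* Up to sign, the Gram determinant of three points of the hyperboloid. *)
set D := _ - _; pose d := (x * (x' ^+ 2 + y' ^+ 2 - x'' ^+ 2 - y'' ^+ 2)
  + x' * (x'' ^+ 2 + y'' ^+ 2 - x ^+ 2 - y ^+ 2)
  + x'' * (x ^+ 2 + y ^+ 2 - x' ^+ 2 - y' ^+ 2)) / (2 * y * y' * y'').
suff -> : D = d ^+ 2 by exact: sqr_ge0.
by rewrite /D /d; field; rewrite !gt_eqF.
Qed.

Lemma hyp_distC z w : hyp_dist z w = hyp_dist w z.
Proof. by rewrite /hyp_dist -![1 + _]/(coshd _ _) coshdC. Qed.

Lemma hyp_dist_eq0 z w : 0 < z.2 -> 0 < w.2 -> hyp_dist z w = 0 -> z = w.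
Proof.
move=> z0 w0 d0; apply: coshd_eq1 => //; apply/eqP.
rewrite eq_le coshd_ge1// andbT leNgt; apply/negP => /arcosh_gt0.
by rewrite -[arcosh _]/(hyp_dist z w) d0 ltxx.
Qed.

Lemma hyp_dist_triangle z w v : 0 < z.2 -> 0 < w.2 -> 0 < v.2 ->
  hyp_dist z v <= hyp_dist z w + hyp_dist w v.
Proof.
move=> *; apply: arcosh_triangle; rewrite ?coshd_ge1//.
exact: coshd_triangle.
Qed.

(** [k] is the squared radius. Circles centred on the real axis are orthogonal when the squared
    distance of the centres is the sum of their [k]; the constants of the pentagon come from 9/4 = 1
    + 5/4 (twice) and 9 = 1 + 8. *)
Definition circle_inversion (c k : R) z : R * R :=
  let n := (z.1 - c) ^+ 2 + z.2 ^+ 2 in (c + k * (z.1 - c) / n, k * z.2 / n).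

(* The consecutive sides [L0], [L2], [L4], [L1], [L3] are the line [x = 0] and
   four half-circles centred on the real axis. *)
Definition pentagon_refl (l : letter) z : R * R :=
  match l with
  | L0 => (- z.1, z.2)
  | L1 => circle_inversion 3 1 z
  | L2 => circle_inversion 0 1 z
  | L3 => circle_inversion 0 8 z
  | L4 => circle_inversion (3 / 2) (5 / 4) z
  end.

(** The hyperbolic sine of the signed distance to the side, nonnegative towards the pentagon, times
    a factor [f]: 1 for the line, twice the radius for a half-circle. The factor keeps the
    coefficients rational; [side_weight] is [2 / f ^+ 2]. *)
Definition side (l : letter) z : R :=
  match l with
  | L0 => z.1
  | L1 => z.1 ^+ 2 + z.2 ^+ 2 - 6 * z.1 + 8
  | L2 => z.1 ^+ 2 + z.2 ^+ 2 - 1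
  | L3 => 8 - z.1 ^+ 2 - z.2 ^+ 2
  | L4 => z.1 ^+ 2 + z.2 ^+ 2 - 3 * z.1 + 1
  end / z.2.

Definition side_weight (l : letter) : R :=
  match l with
  | L0 => 2 | L1 => 1 / 2 | L2 => 1 / 2 | L3 => 1 / 16 | L4 => 2 / 5
  end.

Let norm_neq0 (c x y : R) : 0 < y -> (x - c) ^+ 2 + y ^+ 2 != 0.
Proof. by move=> y0; rewrite gt_eqF// ltr_wpDl ?sqr_ge0// exprn_gt0. Qed.

Lemma pentagon_refl_gt0 l z : 0 < z.2 -> 0 < (pentagon_refl l z).2.
Proof.
case: z => [x y] /= y0; case: l => //=;
  rewrite divr_gt0 ?mulr_gt0 ?ltr_wpDl ?sqr_ge0 ?exprn_gt0//; lra.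
Qed.

(** The formula for a reflection of the hyperboloid, with [side l] as the linear form defining the
    mirror. Isometry, involutivity and commutation follow from it formally, because [coshd] equals 1
    only at equal points. *)
Lemma coshd_refl l z w : 0 < z.2 -> 0 < w.2 ->
  coshd z (pentagon_refl l w) = coshd z w + side_weight l * side l z * side l w.
Proof.
case: z w => [x y] [x' y'] /= y0 y0'.
have := norm_neq0 0 x' y0'; have := norm_neq0 3 x' y0'.
have := norm_neq0 (3 / 2) x' y0' => n32 n3 n0.
have [yn yn'] : y != 0 /\ y' != 0 by rewrite !gt_eqF.
case: l; rewrite /coshd /side /circle_inversion /=; field.
all: rewrite ?yn ?yn' //=.
all: by rewrite gt_eqF// ltr_wpDl ?sqr_ge0// ?mulr_gt0 ?exprn_gt0.
Qed.

Lemma side_refl l z : 0 < z.2 -> side l (pentagon_refl l z) = - side l z.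
Proof.
case: z => [x y] /= y0; have n3 := norm_neq0 3 x y0.
have yn : y != 0 by rewrite gt_eqF.
case: l; rewrite /side /circle_inversion /=; field.
all: rewrite ?yn //=.
all: by rewrite gt_eqF// ltr_wpDl ?sqr_ge0// ?mulr_gt0 ?exprn_gt0.
Qed.

Lemma side_refl_comm i j z : perp i j -> 0 < z.2 ->
  side i (pentagon_refl j z) = side i z.
Proof.
case: z => [x y] /= + y0; have n3 := norm_neq0 3 x y0.
have yn : y != 0 by rewrite gt_eqF.
case: i; case: j => // _; rewrite /side /circle_inversion /=; field.
all: rewrite ?yn //=.
all: by rewrite gt_eqF// ltr_wpDl ?sqr_ge0// ?mulr_gt0 ?exprn_gt0.
Qed.

(* Some positive combination of the two side functions is a positive definite
   quadratic polynomial divided by [z.2]. *)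
Lemma side_disjoint i j z : i != j -> ~~ perp i j -> 0 < z.2 ->
  side j z <= 1 / 4 -> 1 / 4 <= side i z.
Proof.
case: z => [x y] /= + + y0.
have sq1 := sqr_ge0 (x - 3 / 2); have sq2 := sqr_ge0 (x - 3).
have sq3 := sqr_ge0 (y - 1 / 2).
case: i; case: j => // _ _; rewrite /side /= ler_pdivrMr// ler_pdivlMr//; nra.
Qed.

Lemma chamber_bounds z : 0 < z.2 -> (forall l, 0 <= side l z) ->
  0 <= z.1 <= 3 /\ 1 / 4 <= z.2 <= 3.
Proof.
case: z => [x y] /= y0 h; have := (h L0, h L1, h L2, h L3, h L4).
rewrite /side /= !pmulr_lge0 ?invr_gt0// => -[[[[x0 h1] h2] h3] h4].
have y3 : y <= 3 by nra.
have x3 : x <= 3 by nra.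
split; rewrite ?x0 ?x3 ?y3 ?andbT//.
(* Below height 1/4 the discs of [L2], [L4] and [L1] cover the whole range [0 <= x <= 3]; the cuts
   9/10 and 9/4 lie in their overlaps. *)
rewrite leNgt; apply/negP => y4; have y16 : y ^+ 2 < 1 / 16 by nra.
have x1 : 15 / 16 <= x ^+ 2 by nra.
have xl : 9 / 10 <= x by nra.
have [x94|x94] := leP x (9 / 4); nra.
Qed.
End half_plane_geometry.


(** * The half-plane as a metric space, and its chambers *)

Record hpoint (R : realType) := HPoint {
  hcoord :> R * R;
  hpoint_gt0 : (0 < hcoord.2)%R }.

HB.instance Definition _ (R : realType) := [isSub for @hcoord R].
HB.instance Definition _ (R : realType) := [Choice of hpoint R by <:].

Section hyperbolic_metric.
Local Open Scope ring_scope.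
Variable R : realType.
Implicit Types z : hpoint R.

Definition hdist (z w : hpoint R) : R := hyp_dist z w.

Fact hdistxx z : hdist z z = 0.
Proof.
by rewrite /hdist -[hyp_dist _ _]/(arcosh (coshd z z)) coshdxx arcosh1.
Qed.

Fact hdist_eq0 z w : hdist z w = 0 -> z = w.
Proof. by move=> d0; apply/val_inj/hyp_dist_eq0 => //; exact: hpoint_gt0. Qed.

Fact hdistC z w : hdist z w = hdist w z.
Proof. exact: hyp_distC. Qed.

Fact hdist_triangle (w z v : hpoint R) : hdist z v <= hdist z w + hdist w v.
Proof. by apply: hyp_dist_triangle; exact: hpoint_gt0. Qed.

HB.instance Definition _ :=
  isMetric.Build R (hpoint R) hdistxx hdist_eq0 hdistC hdist_triangle.

Lemma mdist_hpointE (z w : hpoint R) : mdist z w = hyp_dist z w.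
Proof. by []. Qed.

Definition hrefl (l : letter) z : hpoint R :=
  HPoint (pentagon_refl_gt0 l (hpoint_gt0 z)).

Local Notation ch z w := (coshd (hcoord z) (hcoord w)).
Local Notation sd l z := (side l (hcoord z)).

Lemma ch_refl l z w :
  ch z (hrefl l w) = ch z w + side_weight R l * sd l z * sd l w.
Proof. exact: coshd_refl (hpoint_gt0 z) (hpoint_gt0 w). Qed.

Lemma ch_eq1 z w : ch z w = 1 -> z = w.
Proof. by move=> e; apply/val_inj/coshd_eq1 => //; exact: hpoint_gt0. Qed.

Lemma sd_refl l z : sd l (hrefl l z) = - sd l z.
Proof. exact: side_refl (hpoint_gt0 z). Qed.

Lemma sd_refl_comm i j z : perp i j -> sd i (hrefl j z) = sd i z.
Proof. by move=> ij; exact: side_refl_comm (hpoint_gt0 z). Qed.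

Lemma sd_disjoint i j z : i != j -> ~~ perp i j ->
  sd j z <= 1 / 4 -> 1 / 4 <= sd i z.
Proof. by move=> ij nij; exact: side_disjoint (hpoint_gt0 z). Qed.

Lemma side_weight_ge l : 1 / 16 <= side_weight R l.
Proof. by case: l => /=; lra. Qed.

Lemma ch_refl2 l z w : ch (hrefl l z) (hrefl l w) = ch z w.
Proof. by rewrite ch_refl sd_refl coshdC ch_refl (coshdC _ z); ring. Qed.

Lemma hrefl_isometry l z w : mdist (hrefl l z) (hrefl l w) = mdist z w.
Proof. by congr arcosh; exact: ch_refl2. Qed.

Lemma hreflK l : involutive (hrefl l).
Proof.
move=> z; apply: ch_eq1.
by rewrite coshdC ch_refl ch_refl sd_refl coshdxx; ring.
Qed.

Lemma hrefl_comm i j z : perp i j -> hrefl i (hrefl j z) = hrefl j (hrefl i z).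
Proof.
move=> ij; have ji : perp j i by rewrite perp_sym.
apply: ch_eq1; rewrite ch_refl ch_refl2 coshdC ch_refl coshdxx.
by rewrite !(sd_refl_comm _ ji) sd_refl; ring.
Qed.

Definition act_letters (w : seq letter) z : hpoint R := foldr hrefl z w.

Lemma act_letters_cat u u' z :
  act_letters (u ++ u') z = act_letters u (act_letters u' z).
Proof. by rewrite /act_letters foldr_cat. Qed.

Lemma act_letters_isometry u z w :
  mdist (act_letters u z) (act_letters u w) = mdist z w.
Proof. by elim: u => //= l u IH; rewrite hrefl_isometry. Qed.

Lemma act_letters_inj u : injective (act_letters u).
Proof. by elim: u => //= l u IH z w /(can_inj (hreflK l))/IH. Qed.

Lemma act_letters_revK u z : act_letters (rev u) (act_letters u z) = z.
Proof.
elim: u z => //= l u IH z; rewrite rev_cons -cats1 act_letters_cat /=.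
by rewrite hreflK IH.
Qed.

Lemma act_letters_Krev u z : act_letters u (act_letters (rev u) z) = z.
Proof. by rewrite -{1}(revK u) act_letters_revK. Qed.

Lemma act_letters_mid i b z : all (perp i) b ->
  act_letters b (hrefl i z) = hrefl i (act_letters b z).
Proof.
by elim: b => //= j b IH /andP[ij hb]; rewrite IH// hrefl_comm// perp_sym.
Qed.

Lemma act_letters_cancel a b c i z : all (perp i) b ->
  act_letters (a ++ i :: b ++ i :: c) z = act_letters (a ++ b ++ c) z.
Proof.
move=> hb; rewrite act_letters_cat [RHS]act_letters_cat /= !act_letters_cat /=.
by rewrite (act_letters_mid _ hb) hreflK.
Qed.

Definition chamber z : Prop := forall l, 0 <= sd l z.

Lemma base_hpoint_gt0 : 0 < ((1, 2) : R * R).2.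
Proof. by []. Qed.

Definition base_hpoint : hpoint R := HPoint base_hpoint_gt0.

Lemma side_base l : 1 / 2 <= sd l base_hpoint.
Proof. by case: l; rewrite /side /=; lra. Qed.

Lemma weight_side_base l : 1 / 32 <= side_weight R l * sd l base_hpoint.
Proof. by have := side_base l; have := side_weight_ge l; nra. Qed.

Lemma chamber_base : chamber base_hpoint.
Proof. by move=> l; have := side_base l; lra. Qed.

(* A reflection in a side that separates [z] from the base point by more than
   1/4 brings [z] closer to it by a definite amount. *)
Lemma move_near_chamber z :
  exists u, forall l, - (1 / 4) <= sd l (act_letters u z).
Proof.
(* Reflecting in a side with value below -1/4 lowers [ch] by at least 1/32 * 1/4 = 1/128, and [ch]
   is never below 1. *)
have [n] : exists n : nat, ch base_hpoint z <= 1 + n%:R / 128.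
  exists (Num.truncn (128 * (ch base_hpoint z - 1))).+1.
  have := truncnS_gt (128 * (ch base_hpoint z - 1)); lra.
elim: n z => [|n IH] z hz.
  exists [::] => l /=; rewrite leNgt; apply/negP => lz.
  have := coshd_ge1 (hpoint_gt0 base_hpoint) (hpoint_gt0 (hrefl l z)).
  rewrite ch_refl; have := weight_side_base l.
  by move: hz; rewrite mul0r addr0; nra.
have [h|] := pselect (forall l, - (1 / 4) <= sd l z); first by exists [::].
move=> /existsNP[l /negP]; rewrite -ltNge => lz.
have [u hu] : exists u, forall k, - (1 / 4) <= sd k (act_letters u (hrefl l z)).
  apply: IH; rewrite ch_refl; move: hz; rewrite -natr1.
  by have := weight_side_base l; nra.
by exists (rcons u l) => k; rewrite -cats1 act_letters_cat.
Qed.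

Let flip l z := if sd l z < 0 then hrefl l z else z.

(** After the reflection [sd l] is at most 1/4, so by [sd_disjoint] every side not perpendicular to
    [l] has value at least 1/4; perpendicular ones are unchanged. Hence one flip per side
    suffices. *)
Let flip_near l z : (forall k, - (1 / 4) <= sd k z) ->
  (forall k, - (1 / 4) <= sd k (flip l z)) /\
  (forall k, (k == l) || (0 <= sd k z) -> 0 <= sd k (flip l z)).
Proof.
move=> hz; rewrite /flip; case: ltP => lz; last first.
  by split=> // k /orP[/eqP->|].
have h k : k != l -> sd k (hrefl l z) = sd k z \/ 1 / 4 <= sd k (hrefl l z).
  move=> kl; have [kl'|kl'] := boolP (perp k l); [left|right].
    exact: sd_refl_comm.
  by apply: (sd_disjoint kl kl'); rewrite sd_refl; have := hz l; lra.
split=> k.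
  have [->|/h[->//|]] := eqVneq k l; last lra.
  by rewrite sd_refl; lra.
have [-> _|/h[->//|]] := eqVneq k l; last lra.
by rewrite sd_refl; lra.
Qed.

(** Coming near the chamber first secures termination: reflecting in a barely violated side may
    bring the point closer by an arbitrarily small amount. *)
Lemma move_to_chamber z : exists u, chamber (act_letters u z).
Proof.
have [u hu] := move_near_chamber z.
have step l y : exists v, flip l y = act_letters v y.
  by rewrite /flip; case: ltP; [exists [:: l]|exists [::]].
suff [v hv] : exists v, chamber (act_letters v (act_letters u z)).
  by exists (v ++ u); rewrite act_letters_cat.
move: (act_letters u z) hu => y hy {z u}.
suff [v [e _ h]] : exists v,
    [/\ foldr flip y [:: L0; L1; L2; L3; L4] = act_letters v y,
    forall k, - (1 / 4) <= sd k (act_letters v y) &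
    forall k, k \in [:: L0; L1; L2; L3; L4] -> 0 <= sd k (act_letters v y)].
  by exists v => -[]; apply: h.
elim: [:: _; _; _; _; _] => [|l s [v [e h1 h2]]]; first by exists [::].
have [v' e'] := step l (act_letters v y); exists (v' ++ v).
have [n1 n2] := flip_near l h1.
rewrite act_letters_cat -e' /= e; split=> // k; rewrite inE => /orP[kl|ks].
  by apply: n2; rewrite kl.
by apply: n2; rewrite h2// orbT.
Qed.

(** A point with side value at least 1/4 in absolute value has [ch] at least 1 + 1/16 * (1/4)^2 to
    its mirror image, as weights are at least 1/16. The final halving comes from the triangle
    inequality in [chamber_displacement]. *)
Definition gap : R := arcosh (1 + 1 / 256) / 2.

Lemma gap_gt0 : 0 < gap.
Proof. by rewrite divr_gt0// arcosh_gt0//; lra. Qed.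

(* The reflection in the side [i] brings the image of [z] back to the side of
   [z], hence the triangle inequality bounds the displacement from below. *)
Lemma chamber_displacement i u z : reduced perp (i :: u) ->
  even_word (i :: u) -> chamber z -> gap <= mdist z (act_letters (i :: u) z).
Proof.
move=> red ev hz.
have far : 1 / 4 <= sd i (act_letters u z).
  apply: (@ping_pong_strict _ perp (fun i u => 0 <= sd i (act_letters u z))
    (fun i u => sd i (act_letters u z) <= 0) _ _ _ _
    (fun i u => 1 / 4 <= sd i (act_letters u z)) i u _ _ red).
  - exact: hz.
  - by move=> k v kv; rewrite /= sd_refl; lra.
  - by move=> k l v kl; rewrite /= sd_refl_comm.
  - move=> k l v kl nkl h.
    have h4 := le_trans h (_ : 0 <= 1 / 4 :> R).
    by have := sd_disjoint kl nkl (h4 _); lra.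
  - by move=> k l v kl; rewrite /= sd_refl_comm.
  - move=> k l v kl nkl h; apply: (sd_disjoint kl nkl).
    by apply: le_trans h _; lra.
  - exact: even_head perp_irr _ _ ev.
set a := act_letters (i :: u) z.
have ai : sd i a <= - (1 / 4) by rewrite /a /= sd_refl; lra.
have le1 : mdist z (hrefl i a) <= mdist z a.
  rewrite /mdist /= /hdist; apply: arcosh_le.
    by apply: coshd_ge1; exact: hpoint_gt0.
  rewrite -![1 + _]/(ch _ _) ch_refl gerDl.
  have wi := side_weight_ge i.
  by apply: mulr_ge0_le0; [apply: mulr_ge0; [lra|exact: hz]|lra].
have le2 : 2 * gap <= mdist a (hrefl i a).
  rewrite /gap mulrC divfK ?pnatr_eq0//; apply: arcosh_le; first lra.
  rewrite -[X in _ <= X]/(ch a (hrefl i a)) ch_refl coshdxx lerD2l.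
  have : 1 / 16 <= sd i a * sd i a by nra.
  by have := side_weight_ge i; rewrite -mulrA; nra.
have := metric_triangle a z (hrefl i a); rewrite (metric_sym a z); lra.
Qed.

End hyperbolic_metric.


(** * Uniform displacement by even words *)

Section orbits.
Local Open Scope ring_scope.
Variable R : realType.
Implicit Types (z : hpoint R) (w v p : seq letter).

Lemma act_letters_cancels w v z : cancels perp w v ->
  act_letters w z = act_letters v z.
Proof. by elim=> // a b c i {}v hb _ <-; exact: act_letters_cancel. Qed.

Lemma even_conj p w : even_word w -> even_word (p ++ w ++ rev p).
Proof.
move=> ew i; rewrite !count_cat count_rev !oddD (negPf (ew i)) addFb addbb.
by [].
Qed.

(** Conjugating by a word that moves [z] into the chamber reduces to [chamber_displacement]. The
    conjugate cannot cancel to the empty word, since [w] moves the base point. *)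
Lemma even_displacement w v z : even_word w -> cancels perp w v ->
  reduced perp v -> v <> [::] -> gap R <= mdist z (act_letters w z).
Proof.
move=> ew wv rv v0.
have nw0 : act_letters w (base_hpoint R) <> base_hpoint R.
  rewrite (act_letters_cancels _ wv); case: v v0 rv wv => // i u _ red wv e.
  have := chamber_displacement red (cancels_even wv ew) (@chamber_base R).
  by rewrite e mdistxx leNgt gap_gt0.
have [p hp] := move_to_chamber z.
have [[|i u] red pu] := cancels_reduced perp (p ++ w ++ rev p).
  case: nw0; apply: (@act_letters_inj _ p).
  rewrite -[in LHS](act_letters_revK p (base_hpoint R)).
  rewrite -(act_letters_cat w) -(act_letters_cat p).
  by rewrite (act_letters_cancels _ pu).
have := chamber_displacement red (cancels_even pu (even_conj p ew)) hp.
rewrite -(act_letters_cancels _ pu) !act_letters_cat act_letters_revK.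
by rewrite act_letters_isometry.
Qed.

Section faithful.
Variables (H : groupType) (y : letter -> H).
Hypothesis yC : forall i j, perp i j -> (y i * y j = y j * y i)%g.
Hypothesis y_faithful :
  forall w, reduced perp w -> w <> [::] -> alt_prod y w <> 1%g.

Lemma even_word_cases w : even_word w ->
  ((forall z, act_letters w z = z) /\ alt_prod y w = 1%g) \/
  ((forall z, gap R <= mdist z (act_letters w z)) /\ alt_prod y w <> 1%g).
Proof.
move=> ew; have [v rv wv] := cancels_reduced perp w.
have [v0|v0] := eqVneq v [::]; [left|right].
  split=> [z|]; first by rewrite (act_letters_cancels z wv) v0.
  by rewrite (alt_prod_cancels perp_irr yC wv) v0.
split=> [z|]; first exact: even_displacement ew wv rv (elimN eqP v0).
rewrite (alt_prod_cancels perp_irr yC wv).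
exact: y_faithful (elimN eqP v0).
Qed.

End faithful.
End orbits.


(** * Lifting along local isometries *)

Section metric_continuity.
Local Open Scope classical_set_scope.
Local Open Scope ring_scope.
Variables (R : realType) (X : pseudoMetricType R) (S : metricType R).
Implicit Types (A : set X) (f : X -> S).

Lemma within_continuousP A f : {within A, continuous f} <->
  forall x, A x -> forall e, 0 < e -> exists2 d, 0 < d &
    forall x', A x' -> ball x d x' -> mdist (f x) (f x') < e.
Proof.
split=> [/subspace_continuousP cf x Ax e e0|h].
  have := cf x Ax; move/metricType_numDomainType.cvgrPdist_lt => /(_ e e0).
  rewrite near_withinE => /nbhs_ballP[d /= d0 hd].
  by exists d => // x' Ax' /hd; exact.
apply/subspace_continuousP => x Ax.
apply/metricType_numDomainType.cvgrPdist_lt => e e0.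
have [d d0 hd] := h x Ax e e0; rewrite near_withinE; apply/nbhs_ballP.
by exists d => // x' /= xx' Ax'; exact: hd.
Qed.

Lemma within_unif_continuous A f : compact A -> {within A, continuous f} ->
  forall e, 0 < e -> exists n : nat, forall x x', A x -> A x' ->
    ball x n.+1%:R^-1 x' -> mdist (f x) (f x') < e.
Proof.
move=> /compact_near_coveringP cA /within_continuousP cf e e0.
have [] := cA nat \oo (fun n x => forall x', A x -> A x' ->
    ball x n.+1%:R^-1 x' -> mdist (f x) (f x') < e) _ _.
  move=> x Ax; have e20 : 0 < e / 2 by rewrite divr_gt0.
  have [d d0 hd] := cf x Ax _ e20.
  have d20 : 0 < d / 2 by rewrite divr_gt0.
  near=> y n => x' Ay Ax' yx'.
  have xy : ball x (d / 2) y by near: y; exact: nbhsx_ballx.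
  have nd : n.+1%:R^-1 <= d / 2 :> R.
    near: n; have := near_infty_natSinv_lt (PosNum d20).
    by apply: filterS => n /= /ltW.
  have xx' : ball x d x'.
    by rewrite [d]splitr; apply: ball_triangle xy (le_ball nd yx').
  have xyd : ball x d y by apply: le_ball xy; rewrite ler_pdivrMr//; lra.
  rewrite [e]splitr (le_lt_trans (metric_triangle _ (f x) _))//.
  by rewrite metric_sym ltrD// hd.
move=> n _ /(_ n (leqnn n)) h; exists n => x x' Ax; exact: h.
Unshelve. all: by end_near. Qed.

Lemma mdist_continuousP (f : S -> X) :
  (forall z e, 0 < e -> exists2 d, 0 < d &
     forall w, mdist z w < d -> ball (f z) e (f w)) ->
  continuous f.
Proof.
move=> h z; apply/cvg_ballP => e e0; have [d d0 hd] := h z e e0.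
have := @nbhsx_ballx R S z d d0; apply: filterS => w.
by rewrite ballEmdist; exact: hd.
Qed.

End metric_continuity.

Section covering.
Local Open Scope classical_set_scope.
Local Open Scope ring_scope.
Variables (R : realType) (T S : metricType R) (pi : T -> S) (r : R).
Hypothesis r0 : 0 < r.
Hypothesis pi_isometry :
  forall z w, mdist z w < r -> mdist (pi z) (pi w) = mdist z w.
Hypothesis pi_lift : forall z b, mdist (pi z) b < r ->
  exists2 w, pi w = b & mdist z w = mdist (pi z) b.

Lemma covering_continuous : continuous pi.
Proof.
move=> z; apply/metricType_numDomainType.cvgrPdist_lt => e e0.
have m0 : 0 < Num.min r e by rewrite lt_min r0.
have := @nbhsx_ballx R T z (Num.min r e) m0; apply: filterS => w.
by rewrite ballEmdist /= lt_min => /andP[zr ze]; rewrite pi_isometry.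
Qed.

Lemma covering_inj z w : mdist z w < r -> pi z = pi w -> z = w.
Proof.
by move=> zw e; apply: mdist_positivity; rewrite -pi_isometry// e mdistxx.
Qed.

Let nearby (z : T) (b : S) : T :=
  xget z [set w | pi w = b /\ mdist z w = mdist (pi z) b].

Let nearbyP z b : mdist (pi z) b < r ->
  pi (nearby z b) = b /\ mdist z (nearby z b) = mdist (pi z) b.
Proof.
move=> /pi_lift[w wb zw]; rewrite /nearby.
by case: xgetP => [y _ []//|/(_ w)[]].
Qed.

(* [chain f n z k t] follows the path [f] stopped at time [t] through its values
   at [i / n], [i <= k]; lifting stopped paths makes gluing unnecessary. *)
Let chain (f : R -> S) (n : nat) (z : T) (k : nat) (t : R) : T :=
  (fix loop k := if k is k'.+1
    then nearby (loop k') (f (Num.min t (k%:R / n%:R))) else z) k.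

Lemma lift_path (f : R -> S) z : {within `[0, 1], continuous f} ->
  pi z = f 0 -> exists g : R -> T, [/\ {within `[0, 1], continuous g},
    g 0 = z & forall t : R, 0 <= t <= 1 -> pi (g t) = f t].
Proof.
move=> cf zf; have r30 : 0 < r / 3 by rewrite divr_gt0.
have [m hm] := within_unif_continuous (@segment_compact R 0 1) cf r30.
have {}hm (t t' : R) : 0 <= t <= 1 -> 0 <= t' <= 1 -> `|t - t'| < m.+1%:R^-1 ->
    mdist (f t) (f t') < r / 3.
  by move=> ? ? ?; apply: hm; rewrite //= in_itv.
(* [m.+2] rather than [m.+1]: a step of length [1 / n] must be strictly below the modulus of
   continuity. *)
pose n := m.+2; have n0 : 0 < n%:R :> R by rewrite ltr0n.
pose s (t : R) (k : nat) : R := Num.min t (k%:R / n%:R).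
have s01 t k : 0 <= t <= 1 -> 0 <= s t k <= 1.
  move=> /andP[t0 t1]; rewrite le_min t0 divr_ge0//= ge_min t1//.
have s_step t k : `|s t k - s t k.+1| < m.+1%:R^-1.
  have lt_inv : n%:R^-1 < m.+1%:R^-1 :> R by rewrite ltf_pV2 ?posrE// ltr_nat.
  apply: le_lt_trans lt_inv.
  have ek : k.+1%:R / n%:R = k%:R / n%:R + n%:R^-1 :> R.
    by rewrite -natr1 mulrDl mul1r.
  have ni0 : 0 < n%:R^-1 :> R by rewrite invr_gt0.
  have min_step (a b : R) : 0 < b -> `|Num.min t a - Num.min t (a + b)| <= b.
    move=> b0; rewrite ler_norml.
    by case: (leP t a) => ?; case: (leP t (a + b)) => ?; lra.
  by rewrite /s ek; exact: min_step.
have s_lip t t' k : `|s t k - s t' k| <= `|t - t'|.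
  rewrite /s; set a := k%:R / _; rewrite ler_norml.
  have n1 := ler_norm (t - t'); have n2 := ler_norm (t' - t).
  rewrite distrC in n2; set b := `|t - t'| in n1 n2 *.
  by case: (leP t a) => ?; case: (leP t' a) => ?; lra.
have s0 k : s 0 k = 0 by rewrite /s min_l// divr_ge0.
have sn t : 0 <= t <= 1 -> s t n = t.
  by move=> /andP[_ t1]; rewrite /s divff ?gt_eqF// min_l.
pose c := chain f n z.
have cS t k : c k.+1 t = nearby (c k t) (f (s t k.+1)) by [].
have near_step t k : 0 <= t <= 1 -> pi (c k t) = f (s t k) ->
    mdist (pi (c k t)) (f (s t k.+1)) < r / 3.
  by move=> t01 ->; apply: hm; rewrite ?s01.
have pic t k : 0 <= t <= 1 -> pi (c k t) = f (s t k).
  move=> t01; elim: k => [|k IH].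
    by rewrite /c /= /s mul0r min_r//; case/andP: t01.
  rewrite cS; apply: (nearbyP _).1.
  by apply: lt_trans (near_step _ _ t01 IH) _; lra.
(* Lifts at nearby times stay as far apart as their images: the detour through the previous points
   has three legs below [r / 3], so [pi] is isometric on the new pair. *)
have cc t t' k : 0 <= t <= 1 -> 0 <= t' <= 1 -> `|t - t'| < m.+1%:R^-1 ->
    mdist (c k t) (c k t') = mdist (f (s t k)) (f (s t' k)).
  move=> t01 t01' tt'; elim: k => [|k IH].
    rewrite /c /= mdistxx /s mul0r !min_r ?mdistxx//;
      by [case/andP: t01'|case/andP: t01].
  rewrite -(pic _ _ t01) -(pic _ _ t01') pi_isometry//.
  have h1 := near_step _ _ t01 (pic _ k t01).
  have h2 := near_step _ _ t01' (pic _ k t01').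
  have lt3 x : x < r / 3 -> x < r by lra.
  have [_ e1] := nearbyP (lt3 _ h1); have [_ e2] := nearbyP (lt3 _ h2).
  have h3 : mdist (c k t) (c k t') < r / 3.
    rewrite IH; apply: hm; rewrite ?s01//.
    exact: le_lt_trans (s_lip _ _ _) tt'.
  rewrite !cS.
  have := metric_triangle (nearby (c k t) (f (s t k.+1))) (c k t)
            (nearby (c k t') (f (s t' k.+1))).
  have := metric_triangle (c k t) (c k t') (nearby (c k t') (f (s t' k.+1))).
  rewrite e2 (metric_sym _ (c k t)) e1; lra.
have c0 k : c k 0 = z.
  elim: k => // k IH; rewrite cS IH s0 -zf.
  have [|_] := @nearbyP z (pi z); first by rewrite mdistxx.
  by rewrite mdistxx => /mdist_positivity.
exists (c n); split.
- apply/within_continuousP => t; rewrite /= in_itv /= => t01 e e0.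
  move/within_continuousP: cf => /(_ t _ e e0); rewrite /= in_itv /=.
  move=> /(_ t01)[d d0 hd]; exists (Num.min d m.+1%:R^-1).
    by rewrite lt_min d0/= invr_gt0.
  move=> t'; rewrite in_itv /= => t01'; rewrite /ball /= lt_min => /andP[td tm].
  rewrite -[mdist _ _]/(mdist (c n t) (c n t')) cc// !sn//.
  by apply: hd => //; rewrite in_itv.
- exact: c0.
- by move=> t t01; rewrite -[pi _]/(pi (c n t)) pic// sn.
Qed.

Lemma mdist_continuous (g h : R -> T) : {within `[0, 1], continuous g} ->
  {within `[0, 1], continuous h} ->
  {within `[0, 1], continuous (fun t => mdist (g t) (h t) : R)}.
Proof.
move=> /within_continuousP cg /within_continuousP ch.
apply/subspace_continuousP => t t01.
apply/pseudometric_normed_Zmodule.cvgrPdist_lt => e e0.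
have e20 : 0 < e / 2 by rewrite divr_gt0.
have [d d0 hd] := cg t t01 _ e20; have [d' d'0 hd'] := ch t t01 _ e20.
rewrite near_withinE; apply/nbhs_ballP.
exists (Num.min d d') => [|t' /=]; first by rewrite /= lt_min d0.
rewrite {1}/ball /= lt_min => /andP[td td'] t01'.
have h1 : mdist (g t) (g t') < e / 2 := hd _ t01' td.
have h2 : mdist (h t) (h t') < e / 2 := hd' _ t01' td'.
have m1 := metric_triangle (g t) (g t') (h t).
have m2 := metric_triangle (g t') (h t') (h t).
have m3 := metric_triangle (g t') (g t) (h t').
have m4 := metric_triangle (g t) (h t) (h t').
rewrite (metric_sym (h t') (h t)) in m2.
rewrite (metric_sym (g t') (g t)) in m3.
rewrite ltr_norml; apply/andP; split; rewrite /from_subspace; lra.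
Qed.

(** The distance between the lifts starts at 0 and never takes the value [r / 2], where [pi] would
    preserve it; the intermediate value theorem keeps it from reaching [r]. *)
Lemma lift_close (g h : R -> T) : {within `[0, 1], continuous g} ->
  {within `[0, 1], continuous h} ->
  (forall t : R, 0 <= t <= 1 -> mdist (pi (g t)) (pi (h t)) < r / 2) ->
  g 0 = h 0 -> mdist (g 1) (h 1) < r.
Proof.
move=> cg ch gh gh0; rewrite ltNge; apply/negP => far.
have mid (d : R) : r <= d -> Num.min 0 d <= r / 2 <= Num.max 0 d.
  have r0' := r0; rewrite le_max ge_min => rd.
  by apply/andP; split; apply/orP; [left|right]; lra.
have [|c] := IVT (@ler01 R) (mdist_continuous cg ch) (v := r / 2).
  by rewrite /= gh0 mdistxx; exact: mid.
have r2r : r / 2 < r by rewrite ltr_pdivrMr// ltr_pMr// ltr1n.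
by rewrite in_itv /= => c01 ec; have := gh c c01; rewrite pi_isometry ec ?ltxx.
Qed.

Lemma lift_unique (g h : R -> T) : {within `[0, 1], continuous g} ->
  {within `[0, 1], continuous h} ->
  (forall t : R, 0 <= t <= 1 -> pi (g t) = pi (h t)) -> g 0 = h 0 -> g 1 = h 1.
Proof.
move=> cg ch gh gh0; apply: covering_inj; last by apply: gh; rewrite ler01 lexx.
by apply: lift_close => // t t01; rewrite gh// mdistxx divr_gt0.
Qed.

(** The homotopy is lifted slice by slice. Lifts of consecutive slices end less than [r] apart over
    the same point [b], hence at the same point. *)
Lemma lift_homotopy (H : R * R -> S) z b (g h : R -> T) :
  {within `[0, 1] `*` `[0, 1], continuous H} ->
  (forall s : R, 0 <= s <= 1 -> H (s, 0) = pi z) ->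
  (forall s : R, 0 <= s <= 1 -> H (s, 1) = b) ->
  {within `[0, 1], continuous g} -> {within `[0, 1], continuous h} ->
  g 0 = z -> h 0 = z ->
  (forall t : R, 0 <= t <= 1 -> pi (g t) = H (0, t)) ->
  (forall t : R, 0 <= t <= 1 -> pi (h t) = H (1, t)) ->
  g 1 = h 1.
Proof.
move=> cH Hl Hr cg ch g0 h0 pig pih; have r20 : 0 < r / 2 by rewrite divr_gt0.
have i0 : 0 <= (0 : R) <= 1 by rewrite lexx ler01.
have i1 : 0 <= (1 : R) <= 1 by rewrite lexx ler01.
have cI2 : compact (`[0, 1] `*` `[0, 1] : set (R * R)).
  by apply: compact_setX; exact: segment_compact.
have [m hm] := within_unif_continuous cI2 cH r20.
have {}hm (s s' t : R) : 0 <= s <= 1 -> 0 <= s' <= 1 -> 0 <= t <= 1 ->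
    `|s - s'| < m.+1%:R^-1 -> mdist (H (s, t)) (H (s', t)) < r / 2.
  move=> s01 s01' t01 ss'; apply: hm; rewrite /= ?in_itv//=.
  by split => //=; rewrite /ball /= subrr normr0 invr_gt0.
pose n := m.+2; have n0 : 0 < n%:R :> R by rewrite ltr0n.
pose s (k : nat) : R := k%:R / n%:R.
have s01 k : (k <= n)%N -> 0 <= s k <= 1.
  by move=> kn; rewrite divr_ge0//= ler_pdivrMr// mul1r ler_nat.
have slice k : (k <= n)%N -> {within `[0, 1], continuous (fun t => H (s k, t))}.
  move=> kn; apply/within_continuousP => t t01 e e0.
  have s01k : `[0, 1]%classic (s k) by rewrite /= in_itv /= s01.
  move/within_continuousP: cH => /(_ (s k, t) (conj s01k t01) e e0)[d d0 hd].
  exists d => // t' t01' tt'; apply: hd => //.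
  by split => //=; rewrite /ball /= subrr normr0.
suff main k (f : R -> T) : (k <= n)%N ->
    {within `[0, 1], continuous f} -> f 0 = z ->
    (forall t : R, 0 <= t <= 1 -> pi (f t) = H (s k, t)) -> g 1 = f 1.
  by apply: (main n) => // t t01; rewrite /s divff ?gt_eqF// pih.
elim: k f => [|k IH] f kn cf f0 pif.
  apply: lift_unique => // [t t01|]; last by rewrite g0.
  by rewrite pif// pig// /s mul0r.
have kn' := ltnW kn.
have [f' [cf' f'0 pif']] := lift_path (slice k kn') (esym (Hl _ (s01 _ kn'))).
rewrite (IH f')//; apply: covering_inj; last by rewrite pif// pif'// !Hr ?s01.
apply: lift_close => // [t t01|]; last by rewrite f'0.
rewrite pif// pif'//; apply: hm; rewrite ?s01//.
rewrite /s -natr1 mulrDl opprD addNKr normrN mul1r ger0_norm ?invr_ge0//.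
by rewrite ltf_pV2 ?posrE// ltr_nat.
Qed.

End covering.


(** * The surface *)

Section orbit_relation.
Local Open Scope classical_set_scope.
Local Open Scope ring_scope.
Variable R : realType.
Implicit Types (z w : hpoint R) (u : seq letter).

Lemma even_cat (u u' : seq letter) :
  even_word u -> even_word u' -> even_word (u ++ u').
Proof. by move=> eu eu' i; rewrite count_cat oddD (negPf (eu i)) eu'. Qed.

Lemma even_rev (u : seq letter) : even_word u -> even_word (rev u).
Proof. by move=> eu i; rewrite count_rev. Qed.

Lemma even_act_gap u : even_word u -> (forall z, act_letters u z = z) \/
  (forall z, gap R <= mdist z (act_letters u z)).
Proof.
move=> eu; have [v rv uv] := cancels_reduced perp u.
have [v0|v0] := eqVneq v [::]; [left|right] => z.
  by rewrite (act_letters_cancels z uv) v0.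
exact: even_displacement eu uv rv (elimN eqP v0).
Qed.

Definition same_orbit : rel (hpoint R) :=
  fun z w => `[< exists2 u, even_word u & w = act_letters u z >].

Fact same_orbit_refl : reflexive same_orbit.
Proof. by move=> z; apply/asboolP; exists [::]. Qed.

Fact same_orbit_sym : symmetric same_orbit.
Proof.
by move=> z w; apply/asboolP/asboolP => -[u eu ->]; exists (rev u);
  rewrite ?act_letters_revK//; exact: even_rev.
Qed.

Fact same_orbit_trans : transitive same_orbit.
Proof.
move=> w z v /asboolP[u eu ->] /asboolP[u' eu' ->]; apply/asboolP.
by exists (u' ++ u); rewrite ?act_letters_cat//; exact: even_cat.
Qed.

Canonical orbit_equiv :=
  EquivRel same_orbit same_orbit_refl same_orbit_sym same_orbit_trans.

End orbit_relation.

Definition surface (R : realType) := {eq_quot (orbit_equiv R)}%qT.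
HB.instance Definition _ (R : realType) := Choice.on (surface R).

Section surface_metric.
Local Open Scope classical_set_scope.
Local Open Scope ring_scope.
Variable R : realType.
Implicit Types (z w : hpoint R) (u : seq letter) (a b : surface R).

Definition sproj z : surface R := (\pi_({eq_quot (orbit_equiv R)}) z)%qT.
Definition srepr a : hpoint R := repr (a : {eq_quot (orbit_equiv R)}%qT).

Lemma sreprK a : sproj (srepr a) = a.
Proof. exact: reprK. Qed.

Lemma sprojP z w :
  sproj z = sproj w <-> exists2 u, even_word u & w = act_letters u z.
Proof.
by split=> [/(@eqmodP _ (orbit_equiv R))/asboolP|h];
  last exact/(@eqmodP _ (orbit_equiv R))/asboolP.
Qed.

Lemma sproj_act u z : even_word u -> sproj (act_letters u z) = sproj z.
Proof. by move=> eu; apply/esym/sprojP; exists u. Qed.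

(** Two lifts of a point within [radius] of [z] differ by an even word moving a point by less than
    [gap], that is, by a trivial one. *)
Definition radius : R := gap R / 2.

Lemma radius_gt0 : 0 < radius.
Proof. by rewrite divr_gt0// gap_gt0. Qed.

Definition near_dists z w : set R :=
  [set t | t < radius /\ exists2 w', sproj w' = sproj w & t = mdist z w'].

Lemma near_dists_inj z w w' : sproj w = sproj w' ->
  mdist z w < radius -> mdist z w' < radius -> w = w'.
Proof.
move=> /sprojP[u eu ->] zw zw'.
have [->//|far] := even_act_gap R eu.
suff : mdist w (act_letters u w) < gap R by rewrite ltNge far.
rewrite (le_lt_trans (metric_triangle _ z _))// [gap R]splitr.
by rewrite ltrD// metric_sym.
Qed.

(* Distances below the injectivity radius are realised by unique lifts; all the
   others are truncated to the radius. *)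
Definition sdist a b : R := xget radius (near_dists (srepr a) (srepr b)).

Lemma near_dists_sproj z w z' w' : sproj z = sproj z' -> sproj w = sproj w' ->
  near_dists z w `<=` near_dists z' w'.
Proof.
move=> /sprojP[u eu ->] ww' t [tr [v vw te]]; split=> //.
exists (act_letters u v); first by rewrite sproj_act// vw.
by rewrite act_letters_isometry.
Qed.

Lemma sdistE z w : mdist z w < radius -> sdist (sproj z) (sproj w) = mdist z w.
Proof.
move=> zw; rewrite /sdist.
have [ez ew] := (sreprK (sproj z), sreprK (sproj w)).
case: xgetP => [t _ /(near_dists_sproj ez ew)[tr [w' w'w te]]|h].
  by rewrite te (@near_dists_inj z w' w)// -te.
case: (h (mdist z w)); apply: (near_dists_sproj (esym ez) (esym ew)).
by split=> //; exists w.
Qed.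

Lemma sdist_lift z b : sdist (sproj z) b < radius ->
  exists2 w, sproj w = b & mdist z w = sdist (sproj z) b.
Proof.
rewrite /sdist.
case: xgetP => [t _ /(near_dists_sproj (sreprK _) (erefl _)) h|].
  by case: h => _ [w]; rewrite sreprK => wb -> _; exists w.
by rewrite ltxx.
Qed.

Lemma sdist_le a b : sdist a b <= radius.
Proof. by rewrite /sdist; case: xgetP => // t _ []/ltW. Qed.

Fact sdistxx a : sdist a a = 0.
Proof. by rewrite -(sreprK a) sdistE mdistxx// radius_gt0. Qed.

Fact sdist_eq0 a b : sdist a b = 0 -> a = b.
Proof.
rewrite -(sreprK a) => ab.
have [|w wb] := @sdist_lift (srepr a) b; first by rewrite ab radius_gt0.
by rewrite ab -wb => /mdist_positivity ->.
Qed.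

Let sdist_sym_le a b : sdist a b <= sdist b a.
Proof.
have [h|] := ltP (sdist b a) radius; last exact/le_trans/sdist_le.
rewrite -(sreprK b) in h *; have [w wa e] := sdist_lift h.
by rewrite -e -{1}wa sdistE metric_sym// e.
Qed.

Fact sdistC a b : sdist a b = sdist b a.
Proof. by apply/eqP; rewrite eq_le !sdist_sym_le. Qed.

Let sdist_ge0 a b : 0 <= sdist a b.
Proof.
have [h|] := ltP (sdist a b) radius; last exact/le_trans/ltW/radius_gt0.
rewrite -(sreprK a) in h *; have [w _ <-] := sdist_lift h.
exact: mdist_ge0.
Qed.

Fact sdist_triangle b a c : sdist a c <= sdist a b + sdist b c.
Proof.
have [h1|h1] := ltP (sdist a b) radius; last first.
  by rewrite (le_trans (sdist_le _ _))// (le_trans h1)// lerDl sdist_ge0.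
have [h2|h2] := ltP (sdist b c) radius; last first.
  by rewrite (le_trans (sdist_le _ _))// (le_trans h2)// lerDr sdist_ge0.
rewrite -(sreprK a) in h1 *; have [w wb e1] := sdist_lift h1.
rewrite -wb in h2 e1 *; have [v <- e2] := sdist_lift h2.
rewrite -e1 -e2; have [h|h] := ltP (mdist (srepr a) v) radius.
  by rewrite sdistE// metric_triangle.
by rewrite (le_trans (sdist_le _ _))// (le_trans h)// metric_triangle.
Qed.

HB.instance Definition _ :=
  isMetric.Build R (surface R) sdistxx sdist_eq0 sdistC sdist_triangle.

Lemma sproj_isometry z w :
  mdist z w < radius -> mdist (sproj z) (sproj w) = mdist z w.
Proof. exact: sdistE. Qed.

Lemma sproj_lift z b : mdist (sproj z) b < radius ->
  exists2 w, sproj w = b & mdist z w = mdist (sproj z) b.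
Proof. exact: sdist_lift. Qed.

Lemma surface_locally_hyperbolic : locally_hyperbolic (surface R).
Proof.
move=> p; set z := srepr p.
pose f q := xget z [set w | sproj w = q /\ mdist z w = mdist p q].
have half_lt : radius / 2 < radius.
  by rewrite ltr_pdivrMr// ltr_pMr ?radius_gt0// ltr1n.
have fP q : mdist p q < radius -> sproj (f q) = q /\ mdist z (f q) = mdist p q.
  rewrite -{1}(sreprK p) => /sproj_lift[w wq]; rewrite sreprK => e.
  by rewrite /f; case: xgetP => [y _ //|/(_ w)]; case.
have half q : mdist p q < radius / 2 -> mdist p q < radius.
  by move/lt_trans; apply.
have fz : f p = z.
  have [|_] := fP p; first by rewrite mdistxx radius_gt0.
  by rewrite mdistxx => /mdist_positivity.
(* Half the radius, so that any two points of the lifted ball are closer than [radius] and [sproj]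
   preserves their distance. *)
exists (radius / 2), (fun q => hcoord (f q)); split.
- by rewrite divr_gt0// radius_gt0.
- exact: hpoint_gt0.
- rewrite fz; split.
  + move=> q; rewrite ballEmdist /= => pq; have [_ e] := fP q (half _ pq).
    by split; [exact: hpoint_gt0|rewrite -mdist_hpointE e].
  + move=> q q'; rewrite !inE !ballEmdist /= => /half/fP[e1 _] /half/fP[e2 _] e.
    by rewrite -e1 -e2; congr sproj; exact: val_inj.
  + move=> w [w0 zw]; pose w' := HPoint w0.
    have zw' : mdist z w' < radius.
      exact: lt_trans zw half_lt.
    have pw : mdist p (sproj w') = mdist z w'.
      by rewrite -(sreprK p) sproj_isometry.
    have [|qe e] := fP (sproj w'); first by rewrite pw.
    exists (sproj w'); first by rewrite ballEmdist /= pw.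
    by rewrite (@near_dists_inj z (f (sproj w')) w')// e pw.
- move=> q q'; rewrite !ballEmdist /= => pq pq'.
  have [e1 e2] := fP _ (half _ pq); have [e3 e4] := fP _ (half _ pq').
  rewrite -mdist_hpointE -{2}e1 -{2}e3 sproj_isometry//.
  have := metric_triangle (f q) z (f q'); rewrite (metric_sym (f q) z) e2 e4.
  by move/le_lt_trans; apply; rewrite [radius]splitr ltrD.
Qed.

End surface_metric.


(** * Coordinates and contraction of the half-plane *)

Section coordinates.
Local Open Scope classical_set_scope.
Local Open Scope ring_scope.
Variable R : realType.
Implicit Types (z w : hpoint R) (c : R * R).

Lemma coshd_lt_arcosh z w (k : R) : 1 <= k -> mdist z w < arcosh k ->
  coshd z w < k.
Proof.
move=> k1 zw; rewrite ltNge; apply/negP => /(arcosh_le k1).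
by rewrite leNgt => /negP; apply.
Qed.

Lemma hcoord_continuous : continuous (@hcoord R).
Proof.
apply: mdist_continuousP => z e e0.
have z0 := hpoint_gt0 z.
(* The bound [k <= 1] forces [w.2 <= 4 * z.2], so the squared Euclidean distance, less than
   [2 * k * z.2 * w.2], is below [8 * k * z.2 ^+ 2]. *)
pose k : R := Num.min 1 (e ^+ 2 / (8 * z.2 ^+ 2)).
have k0 : 0 < k by rewrite lt_min ltr01 divr_gt0 ?mulr_gt0 ?exprn_gt0.
have k1 : k <= 1 by rewrite ge_min lexx.
have ke : k * (8 * z.2 ^+ 2) <= e ^+ 2.
  by rewrite -ler_pdivlMr ?ge_min ?lexx ?orbT// mulr_gt0 ?exprn_gt0.
have d0 : 0 < arcosh (1 + k) by apply: arcosh_gt0; lra.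
exists (arcosh (1 + k)) => // w {d0}.
move=> /coshd_lt_arcosh; rewrite lerDl => /(_ (ltW k0)).
move: z0 (hpoint_gt0 w) ke; case: z k k0 k1 => -[x y] /= _ k k0 k1.
case: w => -[x' y'] /= _ y0 y'0 ke.
rewrite /coshd /= ltrD2l ltr_pdivrMr ?mulr_gt0// => h.
have y4 : y' <= 4 * y.
  rewrite leNgt; apply/negP => yy.
  have : (y - y') ^+ 2 < 2 * y * y'.
    apply: le_lt_trans (_ : _ <= (x - x') ^+ 2 + (y - y') ^+ 2) _.
      by rewrite lerDr sqr_ge0.
    by apply: lt_le_trans h _; rewrite ler_piMl// !mulr_ge0// ltW.
  nra.
have le2 : (x - x') ^+ 2 + (y - y') ^+ 2 < e ^+ 2.
  apply: lt_le_trans h _; apply: le_trans ke; rewrite ler_wpM2l ?(ltW k0)//.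
  nra.
have sq a b : a ^+ 2 + b ^+ 2 < e ^+ 2 -> `|a| < e.
  move=> ab; rewrite -(@ltr_pXn2r _ 2)// ?nnegrE ?normr_ge0 ?(ltW e0)//.
  by rewrite real_normK ?num_real//; have := sqr_ge0 b; lra.
split; rewrite /ball /=; first exact: sq le2.
by apply: (sq _ (x - x')); rewrite addrC.
Qed.

Definition of_coord c : hpoint R := insubd (base_hpoint R) c.

Lemma of_coordK c : 0 < c.2 -> hcoord (of_coord c) = c.
Proof. by move=> c0; rewrite /of_coord -[hcoord _]/(val _) insubdK. Qed.

Lemma hcoordK z : of_coord z = z.
Proof. by apply: val_inj; rewrite /= of_coordK ?hpoint_gt0. Qed.

Lemma arcosh_cvg1 : @arcosh R u @[u --> (1 : R)] --> (0 : R).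
Proof.
rewrite -(@arcosh1 R); rewrite /arcosh.
have cs : Num.sqrt (u ^+ 2 - 1) @[u --> (1 : R)]
    --> Num.sqrt ((1 : R) ^+ 2 - 1).
  have c2 : u ^+ 2 - 1 @[u --> (1 : R)] --> (1 : R) ^+ 2 - 1.
    by apply: cvgB; [exact: exprn_continuous|exact: cvg_cst].
  exact: (cvg_comp _ _ c2 (@sqrt_continuous R _)).
have cu : u + Num.sqrt (u ^+ 2 - 1) @[u --> (1 : R)]
    --> (1 : R) + Num.sqrt ((1 : R) ^+ 2 - 1).
  by apply: cvgD => //; exact: cvg_id.
have pos : 0 < (1 : R) + Num.sqrt ((1 : R) ^+ 2 - 1).
  by rewrite ltr_pwDl ?sqrtr_ge0.
exact: (cvg_comp _ _ cu (continuous_ln pos)).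
Qed.

Lemma coshd_cvg c : 0 < c.2 -> coshd c c' @[c' --> c] --> (1 : R).
Proof.
move=> c0; rewrite -[X in _ --> X](coshdxx c) /coshd.
have c1 : (c' : R * R).1 @[c' --> c] --> c.1 by exact: cvg_fst.
have c2 : (c' : R * R).2 @[c' --> c] --> c.2 by exact: cvg_snd.
apply: cvgD; first exact: cvg_cst.
apply: cvgM; last first.
  apply: cvgV; first by rewrite gt_eqF// !mulr_gt0.
  by apply: cvgM => //; exact: cvg_cst.
have sq (f : R * R -> R) (a : R) : f c' @[c' --> c] --> a ->
    f c' ^+ 2 @[c' --> c] --> a ^+ 2.
  by move=> fa; exact: (cvg_comp _ _ fa (@exprn_continuous R 2 a)).
by apply: cvgD; apply: sq; apply: cvgB => //; exact: cvg_cst.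
Qed.

Lemma of_coord_cvg c : 0 < c.2 -> of_coord c' @[c' --> c] --> of_coord c.
Proof.
move=> c0; apply/metricType_numDomainType.cvgrPdist_lt => e e0.
have h := cvg_comp _ _ (coshd_cvg c0) arcosh_cvg1.
have pos : \forall c' \near c, 0 < (c' : R * R).2.
  have c2 : (c' : R * R).2 @[c' --> c] --> c.2 by exact: cvg_snd.
  exact: (cvgr_gt _ c2 _ c0).
have {}h : \forall c' \near c, arcosh (coshd c c') < e := cvgr_lt _ h _ e0.
near=> c'; rewrite mdist_hpointE !of_coordK//; last by near: c'; exact: pos.
by near: c'; exact: h.
Unshelve. all: by end_near. Qed.

End coordinates.

Section straight_lines.
Local Open Scope classical_set_scope.
Local Open Scope ring_scope.
Variable R : realType.
Implicit Types (z : hpoint R).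
Local Notation z0 := (base_hpoint R).
Local Notation I2 := (`[0, 1] `*` `[0, 1] : set (R * R)).

(** A Euclidean segment instead of a geodesic: the half-plane is convex in the plane, and a
    contraction fixing the base point is all that is sought. *)
Definition line_to_base (s : R) z : hpoint R :=
  of_coord ((1 - s) * z.1 + s * z0.1, (1 - s) * z.2 + s * z0.2).

Lemma line_to_base_gt0 (s : R) z : 0 <= s <= 1 -> 0 < (1 - s) * z.2 + s * z0.2.
Proof. by have := hpoint_gt0 z; rewrite /=; nra. Qed.

Lemma line_to_base0 z : line_to_base 0 z = z.
Proof.
rewrite /line_to_base subr0 !mul1r !mul0r !addr0.
by rewrite -surjective_pairing hcoordK.
Qed.

Lemma line_to_base1 z : line_to_base 1 z = z0.
Proof.
rewrite /line_to_base subrr !mul1r !mul0r !add0r.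
by rewrite -surjective_pairing hcoordK.
Qed.

Lemma line_to_base_base (s : R) : line_to_base s z0 = z0.
Proof.
by rewrite /line_to_base -!mulrDl subrK !mul1r -surjective_pairing hcoordK.
Qed.

Lemma line_to_base_continuous (g : R -> hpoint R) :
  {within `[0, 1], continuous g} ->
  {within I2, continuous (fun st => line_to_base st.1 (g st.2))}.
Proof.
move=> /subspace_continuousP cg.
apply/subspace_continuousP => -[s t] [/= s01 t01].
have c1 : (st : R * R).1 @[st --> within I2 (nbhs (s, t))] --> s.
  by apply: cvg_within_filter; exact: cvg_fst.
have c2 : (st : R * R).2 @[st --> within I2 (nbhs (s, t))] --> t.
  by apply: cvg_within_filter; exact: cvg_snd.
have c2' : (st : R * R).2 @[st --> within I2 (nbhs (s, t))]
    --> within `[0, 1]%classic (nbhs t).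
  move=> P /= tP; have := c2 _ tP; rewrite /nbhs /= /within /= => h.
  by near=> st => -[? ?]; apply: (near h st).
have cc : hcoord (g st.2) @[st --> within I2 (nbhs (s, t))] --> hcoord (g t).
  have cgt := cvg_comp _ _ c2' (cg t t01).
  exact: (cvg_comp _ _ cgt (@hcoord_continuous R (g t))).
have cc1 : (hcoord (g st.2)).1 @[st --> within I2 (nbhs (s, t))]
    --> (hcoord (g t)).1.
  have cf (c : R * R) : (c' : R * R).1 @[c' --> c] --> c.1 by exact: cvg_fst.
  exact: (cvg_comp _ _ cc (cf _)).
have cc2 : (hcoord (g st.2)).2 @[st --> within I2 (nbhs (s, t))]
    --> (hcoord (g t)).2.
  have cf (c : R * R) : (c' : R * R).2 @[c' --> c] --> c.2 by exact: cvg_snd.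
  exact: (cvg_comp _ _ cc (cf _)).
have line (f : R * R -> R) (a b : R) :
    f st @[st --> within I2 (nbhs (s, t))] --> a ->
    (1 - st.1) * f st + st.1 * b @[st --> within I2 (nbhs (s, t))]
    --> (1 - s) * a + s * b.
  move=> fa; apply: cvgD; apply: cvgM => //; last exact: cvg_cst.
  by apply: cvgB => //; exact: cvg_cst.
have cF : ((1 - st.1) * (hcoord (g st.2)).1 + st.1 * z0.1,
           (1 - st.1) * (hcoord (g st.2)).2 + st.1 * z0.2)
    @[st --> within I2 (nbhs (s, t))] -->
    ((1 - s) * (hcoord (g t)).1 + s * z0.1,
     (1 - s) * (hcoord (g t)).2 + s * z0.2).
  exact: (cvg_pair (line _ _ z0.1 cc1) (line _ _ z0.2 cc2)).
have pos : 0 < ((1 - s) * (hcoord (g t)).1 + s * z0.1,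
                (1 - s) * (hcoord (g t)).2 + s * z0.2).2.
  by apply: line_to_base_gt0; move: s01; rewrite in_itv.
exact: (cvg_comp _ _ cF (of_coord_cvg pos)).
Unshelve. all: by end_near. Qed.

End straight_lines.

(** * Connectedness and compactness of the surface *)

Section surface_topology.
Local Open Scope classical_set_scope.
Local Open Scope ring_scope.
Variable R : realType.
Implicit Types (z : hpoint R) (ls : seq letter).
Local Notation z0 := (base_hpoint R).
Local Notation I2 := (`[0, 1] `*` `[0, 1] : set (R * R)).

Lemma sproj_continuous : continuous (@sproj R).
Proof. exact: covering_continuous (@radius_gt0 R) (@sproj_isometry R). Qed.

Lemma within_sproj_continuous (X : topologicalType) (A : set X)
    (f : X -> hpoint R) :
  {within A, continuous f} -> {within A, continuous (@sproj R \o f)}.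
Proof.
move=> /subspace_continuousP cf; apply/subspace_continuousP => x Ax.
exact: (cvg_comp _ _ (cf x Ax) (@sproj_continuous (f x))).
Qed.

Lemma sproj_line_continuous (g : R -> hpoint R) :
  {within `[0, 1], continuous g} ->
  {within I2, continuous (fun st => sproj (line_to_base st.1 (g st.2)))}.
Proof. by move=> cg; exact/within_sproj_continuous/line_to_base_continuous. Qed.

Lemma surface_connected : connected [set: surface R].
Proof.
pose A z : set (surface R) :=
  (fun s : R => sproj (line_to_base s z)) @` `[0, 1].
have cA z : connected (A z).
  apply: connected_continuous_connected; first exact: segment_connected.
  have cz : {within `[0, 1], continuous ((fun=> z) : R -> hpoint R)}.
    by apply: continuous_subspaceT => t; exact: cvg_cst.
  apply/within_continuousP => s s01 e e0.
  have s01' : I2 (s, 0) by split => //=; rewrite in_itv/= lexx ler01.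
  move/within_continuousP: (sproj_line_continuous cz) => /(_ _ s01' e e0).
  move=> [d d0 hd]; exists d => // s' s'01 ss'; apply: (hd (s', 0)).
    by split => //=; rewrite in_itv/= lexx ler01.
  by split => //=; rewrite /ball /= subrr normr0.
have -> : [set: surface R] = \bigcup_(z in [set: hpoint R]) A z.
  apply/esym/seteqP; split=> // a _; exists (srepr a) => //.
  by exists 0; rewrite /= ?in_itv/= ?lexx ?ler01// line_to_base0 sreprK.
apply: bigcup_connected => //.
exists (sproj z0) => z _.
by exists 1; rewrite /= ?in_itv/= ?lexx ?ler01// line_to_base1.
Qed.

Lemma hrefl_continuous l : continuous (@hrefl R l).
Proof.
apply: mdist_continuousP => z e e0; exists e => // w.
by rewrite ballEmdist /= hrefl_isometry.
Qed.

Fixpoint chamber_copies ls : set (hpoint R) :=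
  if ls is l :: ls' then chamber_copies ls' `|` hrefl l @` chamber_copies ls'
  else @of_coord R @` (`[0, 3] `*` `[1 / 4, 3]).

Lemma chamber_copies_compact ls : compact (chamber_copies ls).
Proof.
elim: ls => [|l ls IH] /=.
  apply: continuous_compact; last first.
    by apply: compact_setX; exact: segment_compact.
  apply/subspace_continuousP => c [_ /=]; rewrite in_itv /= => /andP[c2 _].
  apply: cvg_within_filter; apply: of_coord_cvg; lra.
apply: compactU => //; apply: continuous_compact => //.
exact/continuous_subspaceT/hrefl_continuous.
Qed.

Lemma chamber_copies_filter (P : pred letter) ls z : chamber z ->
  chamber_copies ls (act_letters [seq k <- ls | P k] z).
Proof.
move=> hz; elim: ls => [|l ls IH] /=.
  have [z1 z2] := chamber_bounds (hpoint_gt0 z) hz.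
  by exists (hcoord z); rewrite ?hcoordK// /=; rewrite !in_itv.
by case: ifP => _; [right; exists (act_letters [seq k <- ls | P k] z)|left].
Qed.

Lemma surface_compact : compact [set: surface R].
Proof.
pose ls := [:: L0; L1; L2; L3; L4].
have -> : [set: surface R] = @sproj R @` chamber_copies ls.
  apply/esym/seteqP; split=> // a _; have [u hu] := move_to_chamber (srepr a).
  (* The word [u] need not be even. Prefixing each letter of odd multiplicity once repairs this, at
     the price of replacing the chamber by one of its 32 reflected copies. *)
  pose P l := odd (count_mem l u).
  exists (act_letters [seq k <- ls | P k] (act_letters u (srepr a))).
    exact: chamber_copies_filter.
  rewrite -act_letters_cat sproj_act ?sreprK// => l.
  rewrite count_cat oddD count_filter /=.
  by rewrite /P; case: l => /=; rewrite ?add0n ?addn0 oddb addbb.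
apply: continuous_compact; last exact: chamber_copies_compact.
exact/continuous_subspaceT/sproj_continuous.
Qed.

Lemma surface_closed_hyperbolic : closed_hyperbolic_surface (surface R).
Proof.
by split; [exact: surface_compact|exact: surface_connected
  |exact: surface_locally_hyperbolic].
Qed.

End surface_topology.


(** * Holonomy *)

Section holonomy.
Local Open Scope classical_set_scope.
Local Open Scope ring_scope.
Variables (R : realType) (H : groupType) (y : letter -> H).
Hypothesis yC : forall i j, perp i j -> (y i * y j = y j * y i)%g.
Hypothesis y_faithful :
  forall w, reduced perp w -> w <> [::] -> alt_prod y w <> 1%g.
Local Notation z0 := (base_hpoint R).
Local Notation x0 := (sproj z0).
Local Notation I2 := (`[0, 1] `*` `[0, 1] : set (R * R)).
Implicit Types (p q : @loop R (surface R) x0) (u : seq letter).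

(** [rev u ++ u'] is even and fixes [z0], so it lies in the common kernel. Thus the holonomy depends
    on the endpoint of a lift, not on the chosen word. *)
Lemma alt_prod_orbit u u' : even_word u -> even_word u' ->
  act_letters u z0 = act_letters u' z0 -> alt_prod y u = alt_prod y u'.
Proof.
move=> eu eu' e.
have fixed v : even_word v -> act_letters v z0 = z0 -> alt_prod y v = 1%g.
  move=> ev vz; case: (even_word_cases R yC y_faithful ev) => [[_ //]|[far _]].
  by have := far z0; rewrite vz mdistxx leNgt gap_gt0.
have main v : even_word v -> act_letters u z0 = act_letters v z0 ->
    (alt_prod y (rev u) * alt_prod y v = 1)%g.
  move=> ev uv; rewrite -alt_prod_cat//; apply: fixed.
    exact/even_cat/ev/even_rev.
  by rewrite act_letters_cat -uv act_letters_revK.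
apply: (mulgI (alt_prod y (rev u))); rewrite (main u')//; exact: main.
Qed.

Definition lifts_to p u : Prop := even_word u /\ exists g : R -> hpoint R,
  [/\ {within `[0, 1], continuous g}, g 0 = z0,
      forall t : R, 0 <= t <= 1 -> sproj (g t) = p t & g 1 = act_letters u z0].

Lemma loop_lifts p : exists u, lifts_to p u.
Proof.
have [g [cg g0 pig]] := lift_path (@radius_gt0 R) (@sproj_isometry R)
  (@sproj_lift R) (@loop_cts _ _ _ p) (esym (loop0 p)).
have : sproj z0 = sproj (g 1) by rewrite pig ?loop1// ler01 lexx.
by move=> /sprojP[u eu e]; exists u; split=> //; exists g.
Qed.

Lemma lifts_to_homotopic p q u u' : lifts_to p u -> lifts_to q u' ->
  homotopic p q -> alt_prod y u = alt_prod y u'.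
Proof.
move=> [eu [g [cg g0 pig g1]]] [eu' [h [ch h0 pih h1]]] [K [cK K0 K1 Kl Kr]].
apply: alt_prod_orbit => //; rewrite -g1 -h1.
apply: (lift_homotopy (@radius_gt0 R) (@sproj_isometry R) (@sproj_lift R)
  cK Kl Kr cg ch g0 h0) => t t01; [by rewrite pig// K0|by rewrite pih// K1].
Qed.

Lemma within_affine (g : R -> hpoint R) (a b : R) :
  {within `[0, 1], continuous g} ->
  (forall t : R, 0 <= t <= 1 -> 0 <= a * t + b <= 1) ->
  {within `[0, 1], continuous (fun t => g (a * t + b))}.
Proof.
move=> /within_continuousP cg h; apply/within_continuousP => t.
rewrite /= in_itv /= => t01 e e0.
have [|d d0 hd] := cg (a * t + b) _ e e0; first by rewrite /= in_itv /= h.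
have a0 : 0 < `|a| + 1 by rewrite ltr_wpDl.
exists (d / (`|a| + 1)) => [|t']; first by rewrite divr_gt0.
rewrite /= in_itv /= => t01'; rewrite /ball /= ltr_pdivlMr// => tt'.
apply: hd; rewrite /= ?in_itv/= ?h// /ball /=.
rewrite opprD addrACA subrr addr0 -mulrBr normrM mulrC.
apply: le_lt_trans tt'; rewrite ler_wpM2l// lerDl//.
Qed.

Lemma act_letters_within (g : R -> hpoint R) u :
  {within `[0, 1], continuous g} ->
  {within `[0, 1], continuous (fun t => act_letters u (g t))}.
Proof.
move=> /within_continuousP cg; apply/within_continuousP => t t01 e e0.
have [d d0 hd] := cg t t01 e e0; exists d => // t' t01' tt'.
by rewrite act_letters_isometry; exact: hd.
Qed.

Lemma lifts_to_cat p q u u' : lifts_to p u -> lifts_to q u' ->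
  lifts_to (cat_loop p q) (u ++ u').
Proof.
move=> [eu [g [cg g0 pig g1]]] [eu' [h [ch h0 pih h1]]].
split; first exact: even_cat.
have [k [ck k0 pik]] := lift_path (@radius_gt0 R) (@sproj_isometry R)
  (@sproj_lift R) (@loop_cts _ _ _ (cat_loop p q))
  (esym (loop0 (cat_loop p q))).
exists k; split=> //.
have unique := lift_unique (@radius_gt0 R) (@sproj_isometry R).
have khalf : k (2^-1) = act_letters u z0.
  rewrite -g1 -[2^-1]addr0 -[2^-1]mulr1.
  have in01 (t : R) : 0 <= t <= 1 -> 0 <= 2^-1 * t + 0 <= 1 by lra.
  apply: (unique (fun t => k (2^-1 * t + 0))) => // [|t t01|].
  - exact: within_affine.
  - rewrite pik ?in01// pig//= /cat_fun ifT; last lra.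
    by congr (p _); lra.
  - by rewrite mulr0 addr0 k0.
have in01 (t : R) : 0 <= t <= 1 -> 0 <= 2^-1 * t + 2^-1 <= 1 by lra.
(* Moved back by [u], the second half of the lift is a lift of [q] from the base point; hence words
   concatenate in the same order as loops. *)
pose k' t := act_letters (rev u) (k (2^-1 * t + 2^-1)).
have ck' : {within `[0, 1], continuous k'}.
  exact/act_letters_within/within_affine.
have k'0 : k' 0 = z0 by rewrite /k' mulr0 add0r khalf act_letters_revK.
have k'1 : k' 1 = act_letters u' z0.
  rewrite -h1; apply: unique => // [t t01|]; last by rewrite k'0.
  rewrite pih// /k' sproj_act; last exact: even_rev.
  rewrite pik ?in01//= /cat_fun; case: leP => [t0|_]; last by congr (q _); lra.
  (* At the midpoint [cat_fun] still takes its first branch; both loops are at the base point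
     there. *)
  have -> : t = 0 by lra.
  rewrite (_ : 2 * _ = 1) ?loop1 ?loop0//; lra.
rewrite act_letters_cat -k'1 /k' act_letters_Krev; congr k; lra.
Qed.

(** By equality of the kernels [u] acts trivially, so the lift is a closed loop; its contraction
    along segments is projected to the surface. *)
Lemma lifts_to_trivial p u : lifts_to p u -> alt_prod y u = 1%g ->
  homotopic p (cst_loop x0).
Proof.
move=> [eu [g [cg g0 pig g1]]] u1.
have g1' : g 1 = z0.
  rewrite g1.
  by case: (even_word_cases R yC y_faithful eu) => [[-> _]|[_ /(_ u1)]].
exists (fun st => sproj (line_to_base st.1 (g st.2))); split => /=.
- exact: sproj_line_continuous.
- by move=> t t01; rewrite line_to_base0 pig.
- by move=> t _; rewrite line_to_base1.
- by move=> s _; rewrite g0 line_to_base_base.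
- by move=> s _; rewrite g1' line_to_base_base.
Qed.

Definition holonomy (a : fundamental_group R x0) : H :=
  alt_prod y (sval (cid (loop_lifts (pg_repr a)))).

Lemma holonomy_pi p u : lifts_to p u ->
  holonomy (pg_pi (p : loop_pregroup x0)) = alt_prod y u.
Proof.
move=> pu; rewrite /holonomy; case: cid => u' /= pu'.
apply: lifts_to_homotopic pu' pu _.
exact: (pg_repr_pi (p : loop_pregroup x0)).
Qed.

Fact holonomyM : {morph holonomy : a b / (a * b)%g}.
Proof.
move=> a b; rewrite -[a]pg_reprK -[b]pg_reprK -pg_piM.
have [u pu] := loop_lifts (pg_repr a); have [u' pu'] := loop_lifts (pg_repr b).
rewrite (holonomy_pi pu) (holonomy_pi pu') (holonomy_pi (lifts_to_cat pu pu')).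
by rewrite alt_prod_cat//; case: pu'.
Qed.

HB.instance Definition _ :=
  isMultiplicative.Build (fundamental_group R x0) H holonomy holonomyM.

Definition holonomy_morphism : {multiplicative fundamental_group R x0 -> H} :=
  holonomy.

Lemma holonomy_inj : injective holonomy.
Proof.
have ker a : holonomy a = 1%g -> a = 1%g.
  rewrite -[a]pg_reprK; have [u pu] := loop_lifts (pg_repr a).
  by rewrite (holonomy_pi pu) => /(lifts_to_trivial pu) h; apply/pg_piP.
have hol1 : holonomy 1%g = 1%g.
  by apply: (mulgI (holonomy 1%g)); rewrite -holonomyM !mulg1.
move=> a b ab; apply/(mulgI a^-1)%g; rewrite mulVg; apply/esym/ker.
by rewrite holonomyM -ab -holonomyM mulVg.
Qed.

End holonomy.

Theorem corollary7 (R : realType) (m : nat) (hm : 5 <= m)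
    (G : 'I_m -> groupType) (hG : forall v : 'I_m, nontrivial_group (G v)) :
  exists H : groupType,
    hyperbolic_surface_group R H /\
    contains_copy (graph_product (opp_graph (cycle_graph m)) G) H.
Proof.
case: m hm G hG => // n n4 G hG.
pose g v : G v := sval (cid (hG v)).
have g1 v : g v != 1%g by apply/eqP; exact: svalP (cid (hG v)).
have yC := pentagon_eltC (n := n) n4 g.
have y_faithful := pentagon_elt_faithful n4 g1.
exists (fundamental_group R (sproj (base_hpoint R))); split.
  exists (surface R), (sproj (base_hpoint R)); split.
    exact: surface_closed_hyperbolic.
  by exists idfun; exists id.
exists (holonomy_morphism R yC y_faithful); exact: holonomy_inj yC y_faithful.
Qed.
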